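(* Consider a family of parameters $(\delta,\varepsilon)\in(0,1]^2$ for which $G_{\delta,\varepsilon}>0$ and $K_{\delta,\varepsilon}=6L_*/G_{\delta,\varepsilon}<1$. Let $\mathcal B\subset\mathcal X\times\mathcal H$ be bounded and set $$R_u=\sup_{(u_0,v_0)\in\mathcal B}\|u_0\|_{\mathcal X},\qquad R_v=\sup_{(u_0,v_0)\in\mathcal B}\|v_0\|_{\mathcal H}.$$ For $\kappa>0$ let $$\tau^\kappa_{\delta,\varepsilon}=\max\Bigl\{\frac{\kappa\delta}{\omega_f}|\log\delta|,\ \frac{\kappa}{\mu}\varepsilon^2|\log\varepsilon|\Bigr\}.$$ Then, for every $T>0$ and $\kappa>0$, all sufficiently small parameters (in the family) for which $\tau^\kappa_{\delta,\varepsilon}<T$ satisfy $$\sup_{z_0\in\mathcal B}\ \sup_{\tau^\kappa_{\delta,\varepsilon}\le t\le T}\bigl\|\mathbb S_\delta(t)z_0-\Phi_{\delta,\varepsilon}(t-\tau^\kappa_{\delta,\varepsilon})\,\mathcal R_{\delta,\varepsilon}\,\mathbb S_\delta(\tau^\kappa_{\delta,\varepsilon})z_0\bigr\|_{\mathcal X\times\mathcal H}\le C_T\bigl(R_u\delta^\kappa+R_v\varepsilon^\kappa+\delta+\varepsilon^2\bigr),$$ where $C_T$ is independent of sufficiently small $\delta,\varepsilon$ in the chosen parameter family.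
   Context: $\mathcal X$ and $\mathcal H$ are real Hilbert spaces, $\mathcal H$ infinite-dimensional; $\mathcal X\times\mathcal H$ carries the norm $\|(u,v)\|_{\mathcal X\times\mathcal H}=\|u\|_{\mathcal X}+\|v\|_{\mathcal H}$. The fast operator $A_f:\mathrm D(A_f)\subset\mathcal X\to\mathcal X$ is self-adjoint with $A_f\ge\omega_fI$, $\omega_f>0$. The slow operator $A_s:\mathrm D(A_s)\subset\mathcal H\to\mathcal H$ is nonnegative self-adjoint with compact resolvent. The maps $f:\mathcal X\times\mathcal H\to\mathcal X$, $g:\mathcal X\times\mathcal H\to\mathcal H$ are globally bounded and globally Lipschitz; $M_f=\sup\|f\|_{\mathcal X}$, $M_g=\sup\|g\|_{\mathcal H}$, $L_*=\max\{\operatorname{Lip}(f),\operatorname{Lip}(g)\}$. Fix $\mu>0$. For $0<\varepsilon\le1$ let $\Lambda_\varepsilon=\mu\varepsilon^{-2}$, $P_\varepsilon=\mathbf 1_{[0,\Lambda_\varepsilon]}(A_s)$, $Q_\varepsilon=I-P_\varepsilon$, $A_{s,\varepsilon}=A_s+\varepsilon^{-1}Q_\varepsilon$. Put $\beta_\varepsilon=\sup\sigma(A_s|_{P_\varepsilon\mathcal H})$ ($=0$ if $P_\varepsilon\mathcal H=\{0\}$), $\lambda_\varepsilon^+=\inf\sigma(A_s|_{Q_\varepsilon\mathcal H})$, $\alpha_\varepsilon=\lambda_\varepsilon^++\varepsilon^{-1}$, $a_{\delta,\varepsilon}=\min\{\omega_f\delta^{-1},\alpha_\varepsilon\}$, $G_{\delta,\varepsilon}=a_{\delta,\varepsilon}-\beta_\varepsilon$.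 $\mathbb S_\delta(t)$ is the mild-solution semiflow of $\partial_tu+\delta^{-1}A_fu=f(u,v)$, $\partial_tv+A_sv=g(u,v)$, and $\mathbb S_{\delta,\varepsilon}(t)$ that of the renormalized system with $A_s$ replaced by $A_{s,\varepsilon}$. Under $G_{\delta,\varepsilon}>0$ and $K_{\delta,\varepsilon}<1$, the renormalized system has an invariant Lipschitz slow manifold $\mathcal M_{\delta,\varepsilon}=\{J_{\delta,\varepsilon}(p):p\in P_\varepsilon\mathcal H\}$, $J_{\delta,\varepsilon}(p)=(h^u_{\delta,\varepsilon}(p),p+h^q_{\delta,\varepsilon}(p))$, with $h^u_{\delta,\varepsilon}:P_\varepsilon\mathcal H\to\mathcal X$, $h^q_{\delta,\varepsilon}:P_\varepsilon\mathcal H\to Q_\varepsilon\mathcal H$, $\|h^u_{\delta,\varepsilon}\|_{L^\infty}\le M_f\delta/\omega_f$, $\|h^q_{\delta,\varepsilon}\|_{L^\infty}\le M_g/\alpha_\varepsilon$, and $\operatorname{Lip}(h^u_{\delta,\varepsilon})+\operatorname{Lip}(h^q_{\delta,\varepsilon})\le 4L_*/((1-K_{\delta,\varepsilon})G_{\delta,\varepsilon})$. Here $\Phi_{\delta,\varepsilon}(t)=\mathbb S_{\delta,\varepsilon}(t)|_{\mathcal M_{\delta,\varepsilon}}$ and $\mathcal R_{\delta,\varepsilon}(u,v)=J_{\delta,\varepsilon}(P_\varepsilon v)$. *)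

(* Defs.v *)
From Stdlib Require Import Reals.
From Coquelicot Require Import Coquelicot.

Set Implicit Arguments.
Unset Strict Implicit.

Open Scope R_scope.

(** ** Real Hilbert spaces *)

Structure hilbert := Hilbert {
  carrier :> CompleteNormedModule R_AbsRing;
  inner : carrier -> carrier -> R;
  inner_sym : forall x y, inner x y = inner y x;
  inner_plus : forall x y z, inner (plus x y) z = inner x z + inner y z;
  inner_scal : forall (a : R) x y, inner (scal a x) y = a * inner x y;
  inner_norm : forall x, inner x x = norm x ^ 2
}.

Definition infinite_dimensional (H : hilbert) : Prop :=
  forall (n : nat) (e : nat -> H), exists x : H,
  forall c : nat -> R, x <> sum_n (fun i => scal (c i) (e i)) n.

(* Not Coquelicot's norm on products, which is the Euclidean combination. *)
Definition pnorm (X H : hilbert) (z : X * H) : R := norm (fst z) + norm (snd z).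

(** ** Bounds and Lipschitz constants *)

Definition lipschitz_with (E F : AbelianGroup) (nE : E -> R) (nF : F -> R)
    (V : E -> Prop) (h : E -> F) (L : R) : Prop :=
  0 <= L /\
  forall x y, V x -> V y -> nF (minus (h x) (h y)) <= L * nE (minus x y).

Definition lipschitz_on (E F : AbelianGroup) (nE : E -> R) (nF : F -> R)
    (V : E -> Prop) (h : E -> F) : Prop :=
  exists L, lipschitz_with nE nF V h L.

(* The least Lipschitz constant; meaningful only for maps that are Lipschitz. *)
Definition Lip_on (E F : AbelianGroup) (nE : E -> R) (nF : F -> R)
    (V : E -> Prop) (h : E -> F) : R :=
  real (Glb_Rbar (lipschitz_with nE nF V h)).

Definition everywhere (E : Type) : E -> Prop := fun _ => True.

Definition globally_bounded (X H Y : hilbert) (f : X * H -> Y) : Prop :=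
  exists M, forall z, norm (f z) <= M.

Definition sup_norm (X H Y : hilbert) (f : X * H -> Y) : R :=
  real (Lub_Rbar (fun r => exists z, r = norm (f z))).

Definition globally_lipschitz (X H Y : hilbert) (f : X * H -> Y) : Prop :=
  lipschitz_on (@pnorm X H) norm (@everywhere (X * H)) f.

Definition Lip (X H Y : hilbert) (f : X * H -> Y) : R :=
  Lip_on (@pnorm X H) norm (@everywhere (X * H)) f.

(** ** Unbounded operators *)

(* The values of the function outside [dom] carry no meaning. *)
Structure operator (H : hilbert) := Operator {
  dom : H -> Prop;
  app :> H -> H
}.

Definition scal_op (H : hilbert) (a : R) (A : operator H) : operator H :=
  Operator (dom A) (fun x => scal a (A x)).

Definition linear_operator (H : hilbert) (A : operator H) : Prop :=
  dom A zero /\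
  (forall x y, dom A x -> dom A y ->
     dom A (plus x y) /\ A (plus x y) = plus (A x) (A y)) /\
  (forall (a : R) x, dom A x -> dom A (scal a x) /\ A (scal a x) = scal a (A x)).

Definition densely_defined (H : hilbert) (A : operator H) : Prop :=
  forall x (r : R), 0 < r -> exists y, dom A y /\ norm (minus x y) < r.

(* The last clause says that the graph of the adjoint is the graph of A. *)
Definition self_adjoint (H : hilbert) (A : operator H) : Prop :=
  linear_operator A /\ densely_defined A /\
  forall y z,
    (forall x, dom A x -> inner (A x) y = inner x z) <-> (dom A y /\ A y = z).

Definition bounded_below (H : hilbert) (A : operator H) (w : R) : Prop :=
  forall x, dom A x -> w * norm x ^ 2 <= inner (A x) x.

(* [B] is the bounded inverse of A - l on the subspace V (which reduces A). *)
Definition is_resolvent_on (H : hilbert) (V : H -> Prop) (A : operator H)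
    (l : R) (B : H -> H) : Prop :=
  (forall y, V y ->
     V (B y) /\ dom A (B y) /\ minus (A (B y)) (scal l (B y)) = y) /\
  (forall x, V x -> dom A x ->
     V (minus (A x) (scal l x)) /\ B (minus (A x) (scal l x)) = x) /\
  exists M : R, forall y, V y -> norm (B y) <= M * norm y.

(* A self-adjoint operator has real spectrum, so real points suffice. *)
Definition spectrum_on (H : hilbert) (V : H -> Prop) (A : operator H) (l : R) :
    Prop :=
  ~ exists B, is_resolvent_on V A l B.

Definition compact_map (H : hilbert) (B : H -> H) : Prop :=
  forall x : nat -> H, (exists M : R, forall n, norm (x n) <= M) ->
  exists (phi : nat -> nat) (y : H),
    (forall n, (phi n < phi (S n))%nat) /\
    filterlim (fun n => B (x (phi n))) eventually (locally y).

Definition compact_resolvent (H : hilbert) (A : operator H) : Prop :=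
  exists l B, is_resolvent_on (@everywhere H) A l B /\ compact_map B.

(** ** Spectral projections of operators with compact resolvent *)

Inductive span (H : hilbert) (E : H -> Prop) : H -> Prop :=
| span_zero : span E zero
| span_step (a : R) (x y : H) : E x -> span E y -> span E (plus (scal a x) y).

Definition closed_span (H : hilbert) (E : H -> Prop) (x : H) : Prop :=
  forall r : R, 0 < r -> exists y, span E y /\ norm (minus x y) < r.

(* For V a closed subspace, the unique y in V with x - y orthogonal to V. *)
Definition orth_proj (H : hilbert) (V : H -> Prop) (x : H) : H :=
  iota (fun y => V y /\ forall z, V z -> inner (minus x y) z = 0).

(* The functional calculus value 1_S(A) for self-adjoint A with compact
   resolvent: such an A is diagonalized by an orthonormal basis, and 1_S(A)
   keeps exactly the components on the eigenvectors with eigenvalue in S. *)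
Definition spectral_projection (H : hilbert) (A : operator H) (S : R -> Prop) :
    H -> H :=
  orth_proj
    (closed_span (fun x => exists l, S l /\ dom A x /\ A x = scal l x)).

Definition range (E F : Type) (B : E -> F) (y : F) : Prop := exists x, y = B x.

(** ** Semigroups and mild solutions *)

(* [S] is the C0-semigroup generated by -A. *)
Definition is_semigroup_of (H : hilbert) (A : operator H) (S : R -> H -> H) :
    Prop :=
  (forall t, 0 <= t -> is_linear (S t)) /\
  (forall x, S 0 x = x) /\
  (forall s t x, 0 <= s -> 0 <= t -> S (s + t) x = S s (S t x)) /\
  (forall x, filterlim (fun t => S t x) (at_right 0) (locally x)) /\
  (forall x y,
     filterlim (fun t => scal (/ t) (minus (S t x) x)) (at_right 0) (locally y)
     <-> (dom A x /\ y = opp (A x))).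

(* [S t z] is the value at time t of the mild solution issued from z of
   u' + Au u = f (u, v), v' + Av v = g (u, v). *)
Definition is_mild_semiflow (X H : hilbert) (Au : operator X) (Av : operator H)
    (f : X * H -> X) (g : X * H -> H) (S : R -> X * H -> X * H) : Prop :=
  (forall z, S 0 z = z) /\
  (forall s t z, 0 <= s -> 0 <= t -> S (s + t) z = S s (S t z)) /\
  (forall z t, 0 <= t ->
     filterlim (fun s => S s z) (within (fun s => 0 <= s) (locally t))
       (locally (S t z))) /\
  exists (Eu : R -> X -> X) (Ev : R -> H -> H),
    is_semigroup_of Au Eu /\ is_semigroup_of Av Ev /\
    forall z t, 0 <= t ->
      is_RInt (fun s => Eu (t - s) (f (S s z))) 0 t
        (minus (fst (S t z)) (Eu t (fst z))) /\
      is_RInt (fun s => Ev (t - s) (g (S s z))) 0 t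
        (minus (snd (S t z)) (Ev t (snd z))).

(** ** Quantities attached to the slow operator and to (delta, eps) *)

Definition P_ (H : hilbert) (As : operator H) (mu eps : R) : H -> H :=
  spectral_projection As (fun l => 0 <= l <= mu * / eps ^ 2).

Definition Q_ (H : hilbert) (As : operator H) (mu eps : R) (v : H) : H :=
  minus v (P_ As mu eps v).

Definition As_ (H : hilbert) (As : operator H) (mu eps : R) : operator H :=
  Operator (dom As) (fun v => plus (As v) (scal (/ eps) (Q_ As mu eps v))).

(* When P_eps H = {0} the spectrum is empty, its supremum in [Rbar] is
   [m_infty], and [real m_infty = 0], which is the convention for beta. *)
Definition beta_ (H : hilbert) (As : operator H) (mu eps : R) : R :=
  real (Lub_Rbar (spectrum_on (range (P_ As mu eps)) As)).

Definition lambda_plus (H : hilbert) (As : operator H) (mu eps : R) : R :=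
  real (Glb_Rbar (spectrum_on (range (Q_ As mu eps)) As)).

Definition alpha_ (H : hilbert) (As : operator H) (mu eps : R) : R :=
  lambda_plus As mu eps + / eps.

Definition a_ (H : hilbert) (As : operator H) (mu omega delta eps : R) : R :=
  Rmin (omega / delta) (alpha_ As mu eps).

Definition G_ (H : hilbert) (As : operator H) (mu omega delta eps : R) : R :=
  a_ As mu omega delta eps - beta_ As mu eps.

Definition L_star (X H : hilbert) (f : X * H -> X) (g : X * H -> H) : R :=
  Rmax (Lip f) (Lip g).

Definition K_ (X H : hilbert) (As : operator H) (f : X * H -> X)
    (g : X * H -> H) (mu omega delta eps : R) : R :=
  6 * L_star f g / G_ As mu omega delta eps.

(** ** Slow manifolds *)

(* [hu] and [hq] are total functions of which only the restrictions to P_eps H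
   matter; the manifold is J (P_eps H). *)
Definition J_ (X H : hilbert) (hu : H -> X) (hq : H -> H) (p : H) : X * H :=
  (hu p, plus p (hq p)).

Definition is_slow_manifold (X H : hilbert) (As : operator H)
    (f : X * H -> X) (g : X * H -> H) (mu omega delta eps : R)
    (S : R -> X * H -> X * H) (hu : H -> X) (hq : H -> H) : Prop :=
  let PH := range (P_ As mu eps) in
  let QH := range (Q_ As mu eps) in
  let M := fun z => exists p, PH p /\ z = J_ hu hq p in
  (forall p, PH p -> QH (hq p)) /\
  (forall p, PH p -> norm (hu p) <= sup_norm f * delta / omega) /\
  (forall p, PH p -> norm (hq p) <= sup_norm g / alpha_ As mu eps) /\
  lipschitz_on norm norm PH hu /\
  lipschitz_on norm norm PH hq /\
  Lip_on norm norm PH hu + Lip_on norm norm PH hq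
    <= 4 * L_star f g /
         ((1 - K_ As f g mu omega delta eps) * G_ As mu omega delta eps) /\
  (forall t z, 0 <= t -> M z -> M (S t z)).

Definition retraction (X H : hilbert) (As : operator H) (mu eps : R)
    (hu : H -> X) (hq : H -> H) (z : X * H) : X * H :=
  J_ hu hq (P_ As mu eps (snd z)).

(** ** Bounded sets of data and the transient time *)

Definition bounded_set (X H : hilbert) (B : X * H -> Prop) : Prop :=
  exists M, forall z, B z -> pnorm z <= M.

Definition R_u (X H : hilbert) (B : X * H -> Prop) : R :=
  real (Lub_Rbar (fun r => exists z, B z /\ r = norm (fst z))).

Definition R_v (X H : hilbert) (B : X * H -> Prop) : R :=
  real (Lub_Rbar (fun r => exists z, B z /\ r = norm (snd z))).

Definition tau_ (mu omega kappa delta eps : R) : R :=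
  Rmax (kappa * delta / omega * Rabs (ln delta))
       (kappa / mu * eps ^ 2 * Rabs (ln eps)).

(* Main.v *)
(** After the transient time [tau], Duhamel's formula and the decay rates
    [omega / delta] and [mu / eps ^ 2] of the two semigroups make the fast
    component and the high modes of the full solution small; those of the
    renormalized orbit are small because it stays on the slow manifold.  The
    renormalization does not touch the low modes, so their difference satisfies
    a Duhamel equation driven by [g] alone, and Gronwall's lemma bounds it by the
    size of the two other components.

    The analytic input is obtained from the definitions.  The compact resolvent
    gives an eigenvector that minimizes the Rayleigh quotient of [As] on the
    orthogonal complement of the low modes, hence the spectral gap there.  A
    semigroup is only assumed to be strongly right-continuous at 0; the uniform
    boundedness principle makes its orbits continuous, and then energy estimates
    on right derivatives give decay and the invariance of eigenspaces. *)

Require Import Defs.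
From Stdlib Require Import Reals Lra Lia Classical IndefiniteDescription.
From Coquelicot Require Import Coquelicot.
Open Scope R_scope.

(** * Hilbert space algebra *)

(** No eigenbasis is ever constructed. A claim about the low modes is checked on the generating
    eigenvectors and extends because it defines a closed subspace. On the orthogonal complement only
    a bound of the quadratic form is available; it holds because an eigenvector there with
    eigenvalue below the cutoff would itself be a low mode, hence orthogonal to itself. Orbits of a
    semigroup are differentiable only from the right and only for data in the domain. Each
    invariance or decay statement is therefore reduced to a real function with a one-sided
    derivative bound, then extended by density. The renormalized operator enters through its
    eigenvectors in the low modes and through its pairing with them; its self-adjointness is not
    established. The infimum of an empty spectrum becomes 0 under [real], so [alpha_] is bounded
    below only once a nonzero high mode is known. The terms in [delta] and [eps ^ 2] each arise
    twice: as forcing divided by decay rate in Duhamel's formula, and as the size of the graph maps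
    of the manifold. *)

Lemma inner_plus_r (H : hilbert) (x y z : H) :
  inner x (plus y z) = inner x y + inner x z.
Proof. now rewrite inner_sym, inner_plus, (inner_sym y), (inner_sym z). Qed.

Lemma inner_scal_r (H : hilbert) (a : R) (x y : H) :
  inner x (scal a y) = a * inner x y.
Proof. now rewrite inner_sym, inner_scal, inner_sym. Qed.

Lemma inner_opp (H : hilbert) (x y : H) : inner (opp x) y = - inner x y.
Proof.
  assert (E : scal (-1) x = opp x) by exact (scal_opp_one x).
  rewrite <- E, inner_scal. ring.
Qed.

Lemma inner_opp_r (H : hilbert) (x y : H) : inner x (opp y) = - inner x y.
Proof. now rewrite inner_sym, inner_opp, inner_sym. Qed.

Lemma inner_minus (H : hilbert) (x y z : H) :
  inner (minus x y) z = inner x z - inner y z.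
Proof. unfold minus. rewrite inner_plus, inner_opp. ring. Qed.

Lemma inner_minus_r (H : hilbert) (x y z : H) :
  inner x (minus y z) = inner x y - inner x z.
Proof. now rewrite inner_sym, inner_minus, (inner_sym y), (inner_sym z). Qed.

Lemma inner_zero (H : hilbert) (x : H) : inner zero x = 0.
Proof.
  assert (E : minus x x = (zero : H)) by exact (minus_eq_zero x).
  rewrite <- E, inner_minus. ring.
Qed.

Lemma inner_zero_r (H : hilbert) (x : H) : inner x zero = 0.
Proof. now rewrite inner_sym, inner_zero. Qed.

Lemma norm_eq_0 (H : hilbert) (x : H) : norm x = 0 -> x = (zero : H).
Proof. exact (@norm_eq_zero _ _ x). Qed.

Lemma norm_nonneg (H : hilbert) (x : H) : 0 <= norm x.
Proof. exact (norm_ge_0 x). Qed.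

Lemma inner_ext (H : hilbert) (x y : H) :
  (forall w, inner x w = inner y w) -> x = y.
Proof.
  intros E.
  assert (N : norm (minus x y) = 0).
  { assert (I := inner_norm (minus x y)).
    rewrite inner_minus, (E (minus x y)) in I. nra. }
  apply norm_eq_0 in N.
  assert (E1 : plus (minus x y) y = x).
  { unfold minus.
    transitivity (plus x (plus (opp y) y)); [exact (eq_sym (plus_assoc _ _ _))|].
    transitivity (plus x zero); [f_equal; exact (plus_opp_l y) | exact (plus_zero_r x)]. }
  rewrite <- E1, N. exact (plus_zero_l y).
Qed.

Ltac inner_simpl :=
  repeat rewrite ?inner_minus, ?inner_minus_r, ?inner_plus, ?inner_plus_r,
    ?inner_scal, ?inner_scal_r, ?inner_opp, ?inner_opp_r,
    ?inner_zero, ?inner_zero_r.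

(** Pairing with an arbitrary vector turns a linear identity between vectors into a [ring] identity
    between real numbers. *)
Ltac vec := apply inner_ext; let w := fresh in intro w; inner_simpl; ring.

Lemma norm_minus_sq (H : hilbert) (x y : H) :
  norm (minus x y) ^ 2 = norm x ^ 2 - 2 * inner x y + norm y ^ 2.
Proof.
  rewrite <- !inner_norm. inner_simpl. rewrite (inner_sym y x). ring.
Qed.

Lemma norm_plus_sq (H : hilbert) (x y : H) :
  norm (plus x y) ^ 2 = norm x ^ 2 + 2 * inner x y + norm y ^ 2.
Proof.
  rewrite <- !inner_norm. inner_simpl. rewrite (inner_sym y x). ring.
Qed.

Lemma norm_scal_eq (H : hilbert) (a : R) (x : H) :
  norm (scal a x) = Rabs a * norm x.
Proof.
  apply Rsqr_inj.
  - apply norm_nonneg.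
  - apply Rmult_le_pos; [apply Rabs_pos | apply norm_nonneg].
  - rewrite Rsqr_mult, <- Rsqr_abs. unfold Rsqr.
    assert (I := inner_norm (scal a x)). rewrite inner_scal, inner_scal_r in I.
    rewrite inner_norm in I. nra.
Qed.

Lemma norm_zero_eq (H : hilbert) : norm (zero : H) = 0.
Proof. assert (I := inner_norm (zero : H)). rewrite inner_zero in I. nra. Qed.

Lemma norm_plus_le (H : hilbert) (x y : H) : norm (plus x y) <= norm x + norm y.
Proof. exact (norm_triangle x y). Qed.

Lemma norm_minus_self (H : hilbert) (x : H) : norm (minus x x) = 0.
Proof.
  assert (I := inner_norm (minus x x)). rewrite inner_minus in I. nra.
Qed.

Lemma norm_axpy_le (H : hilbert) (a : R) (x y : H) :
  norm (plus (scal a x) y) <= Rabs a * norm x + norm y.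
Proof. rewrite <- norm_scal_eq. apply norm_plus_le. Qed.

Lemma norm_minus_sym (H : hilbert) (x y : H) :
  norm (minus x y) = norm (minus y x).
Proof.
  assert (I : norm (minus x y) ^ 2 = norm (minus y x) ^ 2).
  { rewrite !norm_minus_sq, (inner_sym y x). ring. }
  assert (I1 := norm_nonneg _ (minus x y)).
  assert (I2 := norm_nonneg _ (minus y x)). nra.
Qed.

Lemma norm_triangle_minus (H : hilbert) (x y z : H) :
  norm (minus x z) <= norm (minus x y) + norm (minus y z).
Proof.
  replace (minus x z) with (plus (minus x y) (minus y z)) by vec.
  exact (norm_triangle _ _).
Qed.

Lemma norm_le_minus (H : hilbert) (x y : H) :
  norm x <= norm y + norm (minus x y).
Proof.
  replace x with (plus y (minus x y)) at 1 by vec. exact (norm_triangle _ _).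
Qed.

Lemma norm_minus_le (H : hilbert) (x y : H) :
  norm (minus x y) <= norm x + norm y.
Proof.
  replace (minus x y) with (plus x (scal (-1) y)) by vec.
  eapply Rle_trans; [exact (norm_triangle _ _)|].
  rewrite norm_scal_eq, Rabs_left by lra. lra.
Qed.

Lemma cauchy_schwarz (H : hilbert) (x y : H) :
  Rabs (inner x y) <= norm x * norm y.
Proof.
  assert (Hx := norm_nonneg _ x). assert (Hy := norm_nonneg _ y).
  destruct (Req_dec (norm y) 0) as [Z|Z].
  - rewrite (norm_eq_0 _ _ Z), inner_zero_r, norm_zero_eq, Rabs_R0. lra.
  - assert (I := inner_norm (minus (scal (norm y ^ 2) x) (scal (inner x y) y))).
    assert (P := pow2_ge_0 (norm (minus (scal (norm y ^ 2) x) (scal (inner x y) y)))).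
    rewrite <- I in P. revert P. inner_simpl.
    rewrite (inner_sym y x), (inner_norm x), (inner_norm y). intros P.
    assert (0 < norm y ^ 2) by nra.
    assert (I2 : Rabs (inner x y) ^ 2 <= (norm x * norm y) ^ 2).
    { rewrite pow2_abs. apply Rmult_le_reg_l with (norm y ^ 2); [assumption|]. nra. }
    apply Rsqr_incr_0_var; [unfold Rsqr; nra | nra].
Qed.

Lemma sq_le_le (a b : R) : 0 <= b -> a ^ 2 <= b ^ 2 -> a <= b.
Proof. intros. apply Rsqr_incr_0_var; [unfold Rsqr; nra | assumption]. Qed.

(** * Orthogonal projections *)

(** Form in which all approximation arguments end. The restriction [e <= 1] lets quadratic errors be
    absorbed into the linear one. *)
Lemma small_zero (a C : R) :
  (forall e, 0 < e -> e <= 1 -> Rabs a <= C * e) -> a = 0.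
Proof.
  intros h. destruct (Req_dec a 0) as [|n]; [assumption|].
  assert (0 < Rabs a) by now apply Rabs_pos_lt.
  assert (0 < Rabs C + 1) by (assert (I := Rabs_pos C); lra).
  set (e := Rmin 1 (Rabs a / (2 * (Rabs C + 1)))).
  assert (he : 0 < e) by (apply Rmin_pos; [lra | apply Rdiv_lt_0_compat; lra]).
  assert (h1 := h e he (Rmin_l _ _)).
  assert (C * e <= (Rabs C + 1) * e).
  { apply Rmult_le_compat_r; [lra|]. assert (I := Rle_abs C). lra. }
  assert (h2 : e <= Rabs a / (2 * (Rabs C + 1))) by apply Rmin_r.
  apply (Rmult_le_compat_l (Rabs C + 1)) in h2; [|lra].
  replace ((Rabs C + 1) * (Rabs a / (2 * (Rabs C + 1)))) with (Rabs a / 2) in h2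
    by (field; lra).
  lra.
Qed.

Lemma le_of_small (a b C : R) :
  (forall e, 0 < e -> e <= 1 -> a <= b + C * e) -> a <= b.
Proof.
  intros h. destruct (Rle_lt_dec a b) as [|n]; [assumption|].
  assert (E : Rmax 0 (a - b) = 0); [|rewrite Rmax_right in E; lra].
  apply (small_zero _ C). intros e he h1. specialize (h e he h1).
  rewrite Rmax_right by lra. rewrite Rabs_right by lra. lra.
Qed.

(** Completeness for sets of approximations: [P r] collects the candidates of accuracy [r], and
    these sets generate a Cauchy filter. No sequence has to be chosen. It yields minimizers,
    preimages under an operator bounded below, and the common point of nested balls. *)
Lemma cauchy_family (H : hilbert) (P : R -> H -> Prop) :
  (forall r, 0 < r -> exists y, P r y) ->
  (forall r s y, 0 < r <= s -> P r y -> P s y) ->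
  (forall e, 0 < e -> exists r, 0 < r /\
     forall y1 y2, P r y1 -> P r y2 -> norm (minus y1 y2) < e) ->
  exists l : H, forall e, 0 < e -> exists r, 0 < r /\
     forall y, P r y -> norm (minus y l) < e.
Proof.
  intros ex mono cau.
  set (F := fun U : H -> Prop => exists r, 0 < r /\ forall y, P r y -> U y).
  assert (PF : ProperFilter F).
  { split.
    - intros U [r [hr h]]. destruct (ex r hr) as [y hy]. exists y. auto.
    - split.
      + exists 1. split; [lra | auto].
      + intros U1 U2 [r1 [hr1 h1]] [r2 [hr2 h2]]. exists (Rmin r1 r2).
        assert (0 < Rmin r1 r2) by now apply Rmin_pos.
        split; [assumption|]. intros y hy. split.
        * apply h1. apply (mono (Rmin r1 r2)); [|assumption].
          split; [assumption | apply Rmin_l].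
        * apply h2. apply (mono (Rmin r1 r2)); [|assumption].
          split; [assumption | apply Rmin_r].
      + intros U1 U2 i [r [hr h]]. exists r. auto. }
  assert (CF : cauchy F).
  { intros eps. destruct (cau eps (cond_pos eps)) as [r [hr h]].
    destruct (ex r hr) as [y hy]. exists y, r. split; [assumption|].
    intros z hz. apply (norm_compat1 y z eps). apply h; assumption. }
  exists (lim F). intros e he.
  assert (N := norm_factor_gt_0 (V := H)).
  assert (hp : 0 < e / norm_factor (V := H)) by now apply Rdiv_lt_0_compat.
  destruct (complete_cauchy F PF CF (mkposreal _ hp)) as [r [hr h]].
  exists r. split; [assumption|]. intros y hy.
  assert (I := norm_compat2 (V := H) (lim F) y (mkposreal _ hp) (h y hy)).
  simpl in I. replace (norm_factor * (e / norm_factor)) with e in I by (field; lra).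
  exact I.
Qed.

(** The single clause for [a x + y] matches the constructor [span_step]; closedness is
    sequence-free, as in [closed_span]. *)
Definition closed_subspace (H : hilbert) (V : H -> Prop) : Prop :=
  V zero /\
  (forall (a : R) (x y : H), V x -> V y -> V (plus (scal a x) y)) /\
  (forall x, (forall r, 0 < r -> exists y, V y /\ norm (minus x y) < r) -> V x).

Lemma closed_subspace_scal (H : hilbert) (V : H -> Prop) (a : R) (x : H) :
  closed_subspace H V -> V x -> V (scal a x).
Proof.
  intros [Z [L _]] hx. replace (scal a x) with (plus (scal a x) (zero : H)) by vec.
  now apply L.
Qed.

Lemma closed_subspace_plus (H : hilbert) (V : H -> Prop) (x y : H) :
  closed_subspace H V -> V x -> V y -> V (plus x y).
Proof.
  intros [Z [L _]] hx hy. replace (plus x y) with (plus (scal 1 x) y) by vec.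
  now apply L.
Qed.

Lemma closed_subspace_minus (H : hilbert) (V : H -> Prop) (x y : H) :
  closed_subspace H V -> V x -> V y -> V (minus x y).
Proof.
  intros [Z [L _]] hx hy. replace (minus x y) with (plus (scal (-1) y) x) by vec.
  now apply L.
Qed.

Definition perp (H : hilbert) (V : H -> Prop) (x : H) : Prop :=
  forall z, V z -> inner x z = 0.

Lemma closed_subspace_perp (H : hilbert) (V : H -> Prop) :
  closed_subspace H (perp H V).
Proof.
  split; [|split].
  - intros z _. apply inner_zero.
  - intros a x y hx hy z hz. inner_simpl. rewrite hx, hy by assumption. ring.
  - intros x hx z hz. apply (small_zero _ (norm z)). intros e he _.
    destruct (hx e he) as [y [hy hn]].
    assert (I := cauchy_schwarz _ (minus x y) z).
    rewrite inner_minus, (hy z hz) in I. assert (I2 := norm_nonneg _ z).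
    replace (inner x z) with (inner x z - 0) by ring. nra.
Qed.

Lemma closed_subspace_all (H : hilbert) : closed_subspace H (@everywhere H).
Proof. repeat split. Qed.

Lemma inf_approx (S : R -> Prop) :
  (exists s, S s) -> (forall s, S s -> 0 <= s) ->
  forall r, 0 < r -> exists s, S s /\ forall s', S s' -> s <= s' + r.
Proof.
  intros [s0 h0] pos r hr.
  destruct (completeness (fun t => S (- t))) as [m [ub lub]].
  - exists 0. intros t ht. apply pos in ht. lra.
  - exists (- s0). now rewrite Ropp_involutive.
  - apply NNPP. intros no.
    assert (m <= m - r); [|lra]. apply lub. intros t ht.
    destruct (Rle_lt_dec t (m - r)) as [|lt]; [assumption|]. exfalso. apply no.
    exists (- t). split; [assumption|]. intros s' hs'.
    assert (- s' <= m) by (apply ub; now rewrite Ropp_involutive). lra.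
Qed.

Lemma near_minimizer (H : hilbert) (V : H -> Prop) (x : H) (r : R) :
  V zero -> 0 < r ->
  exists y, V y /\
    forall z, V z -> norm (minus x y) ^ 2 <= norm (minus x z) ^ 2 + r.
Proof.
  intros Z hr.
  destruct (inf_approx (fun s => exists y, V y /\ s = norm (minus x y) ^ 2))
    with (r := r) as [s [[y [hy ->]] h]].
  - exists (norm (minus x (zero : H)) ^ 2), (zero : H). auto.
  - intros s [y [_ ->]]. apply pow2_ge_0.
  - assumption.
  - exists y. split; [assumption|]. intros z hz. apply h. exists z. auto.
Qed.

(** By the parallelogram law near-minimizers of the distance to [V] are close to each other;
    orthogonality is the first-order condition at their limit. *)
Lemma projection_exists (H : hilbert) (V : H -> Prop) (x : H) :
  closed_subspace H V -> exists y, V y /\ perp H V (minus x y).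
Proof.
  intros CV. assert (CV' := CV). destruct CV' as [Z [L C]].
  set (P := fun r (y : H) => V y /\ forall z, V z ->
              norm (minus x y) ^ 2 <= norm (minus x z) ^ 2 + r).
  destruct (cauchy_family H P) as [l hl].
  - intros r hr.
    now apply near_minimizer.
  - intros r s y hr [hy h]. split; [assumption|]. intros z hz.
    specialize (h z hz). lra.
  (* Two minimizers up to error [r] satisfy [norm (y1 - y2) ^ 2 <= 4 r], by comparison with their
     midpoint [m]. *)
  - intros e he. exists (e ^ 2 / 8). split; [nra|].
    intros y1 y2 [hy1 h1] [hy2 h2].
    set (m := scal (/ 2) (plus y1 y2)).
    assert (hm : V m).
    { apply closed_subspace_scal; [assumption|]. now apply closed_subspace_plus. }
    assert (I : norm (minus y1 y2) ^ 2 = 2 * norm (minus x y1) ^ 2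
              + 2 * norm (minus x y2) ^ 2 - 4 * norm (minus x m) ^ 2).
    { rewrite <- !inner_norm. unfold m. inner_simpl.
      rewrite (inner_sym y1 x), (inner_sym y2 x), (inner_sym y2 y1). field. }
    specialize (h1 m hm). specialize (h2 m hm).
    assert (norm (minus y1 y2) ^ 2 <= e ^ 2 / 2) by lra.
    assert (I2 := norm_nonneg _ (minus y1 y2)). nra.
  - exists l. split.
    + apply C. intros r hr. destruct (hl r hr) as [s [hs h]].
      destruct (near_minimizer H V x s Z hs) as [y hy].
      exists y. split; [apply hy|]. rewrite norm_minus_sym. now apply h.
    + intros z hz. apply (small_zero _ ((norm z ^ 2 + 1) / 2 + norm z)).
      intros e he h1. destruct (hl e he) as [s [hs h]].
      (* The error [e ^ 2] is matched to variations of length [t = e] and [t = - e]: after division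
         by [2 e] the inner product is of order [e]. *)
      assert (hr : 0 < Rmin s (e ^ 2)) by (apply Rmin_pos; [assumption | nra]).
      destruct (near_minimizer H V x _ Z hr) as [y [hy hmin]].
      assert (hy2 : norm (minus y l) < e).
      { apply h. split; [assumption|]. intros w hw. specialize (hmin w hw).
        assert (I := Rmin_l s (e ^ 2)). lra. }
      assert (var : forall t, 2 * t * inner (minus x y) z <= t ^ 2 * norm z ^ 2 + e ^ 2).
      { intros t. assert (hw := hmin (plus (scal t z) y) (L t z y hz hy)).
        assert (E : norm (minus x (plus (scal t z) y)) ^ 2 = norm (minus x y) ^ 2
            - 2 * t * inner (minus x y) z + t ^ 2 * norm z ^ 2).
        { rewrite <- !inner_norm. inner_simpl.
          rewrite (inner_sym z x), (inner_sym y x), (inner_sym z y). ring. }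
        assert (I := Rmin_r s (e ^ 2)). lra. }
      assert (v1 := var e). assert (v2 := var (- e)).
      assert (cs := cauchy_schwarz _ (minus y l) z).
      assert (B : Rabs (inner (minus x y) z) <= e * ((norm z ^ 2 + 1) / 2)).
      { apply Rabs_le. split; apply (Rmult_le_reg_l (2 * e)); nra. }
      replace (inner (minus x l) z) with (inner (minus x y) z + inner (minus y l) z)
        by (inner_simpl; ring).
      assert (N := norm_nonneg _ z).
      eapply Rle_trans; [apply Rabs_triang|]. nra.
Qed.

Lemma eq_of_norm_minus (H : hilbert) (x y : H) : norm (minus x y) = 0 -> x = y.
Proof.
  intros N. apply norm_eq_0 in N. apply inner_ext. intros w.
  assert (E := inner_minus _ x y w). rewrite N, inner_zero in E. lra.
Qed.

Lemma projection_unique (H : hilbert) (V : H -> Prop) (x y y' : H) :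
  closed_subspace H V -> V y -> perp H V (minus x y) ->
  V y' -> perp H V (minus x y') -> y = y'.
Proof.
  intros CV hy py hy' py'.
  assert (hd : V (minus y y')) by now apply closed_subspace_minus.
  assert (I := inner_norm (minus y y')).
  assert (E : inner (minus y y') (minus y y') =
     inner (minus x y') (minus y y') - inner (minus x y) (minus y y')).
  { inner_simpl. ring. }
  rewrite (py _ hd), (py' _ hd) in E. apply eq_of_norm_minus. nra.
Qed.

Lemma orth_proj_spec (H : hilbert) (V : H -> Prop) (x : H) :
  closed_subspace H V ->
  V (orth_proj V x) /\ perp H V (minus x (orth_proj V x)).
Proof.
  intros CV. unfold orth_proj.
  apply (iota_correct (V := H) (fun y => V y /\ forall z, V z -> inner (minus x y) z = 0)).
  destruct (projection_exists H V x CV) as [y [hy py]].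
  exists y. split; [now split|].
  intros y' [hy' py']. now apply (projection_unique H V x).
Qed.

Lemma orth_proj_unique (H : hilbert) (V : H -> Prop) (x y : H) :
  closed_subspace H V -> V y -> perp H V (minus x y) -> orth_proj V x = y.
Proof.
  intros CV hy py. destruct (orth_proj_spec H V x CV) as [hy' py'].
  now apply (projection_unique H V x).
Qed.

Lemma orth_proj_of_mem (H : hilbert) (V : H -> Prop) (x : H) :
  closed_subspace H V -> V x -> orth_proj V x = x.
Proof.
  intros CV hx. apply orth_proj_unique; [assumption|assumption|].
  intros z _. inner_simpl. ring.
Qed.

Lemma orth_proj_of_perp (H : hilbert) (V : H -> Prop) (x : H) :
  closed_subspace H V -> perp H V x -> orth_proj V x = zero.
Proof.
  intros CV hx. apply orth_proj_unique; [assumption | exact (proj1 CV) |].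
  intros z hz. inner_simpl. rewrite hx by assumption. ring.
Qed.

Lemma orth_proj_plus (H : hilbert) (V : H -> Prop) (x y : H) :
  closed_subspace H V ->
  orth_proj V (plus x y) = plus (orth_proj V x) (orth_proj V y).
Proof.
  intros CV. destruct (orth_proj_spec H V x CV) as [hx px].
  destruct (orth_proj_spec H V y CV) as [hy py].
  apply orth_proj_unique; [assumption | now apply closed_subspace_plus |].
  intros z hz. specialize (px z hz). specialize (py z hz). revert px py.
  inner_simpl. intros. lra.
Qed.

Lemma orth_proj_scal (H : hilbert) (V : H -> Prop) (a : R) (x : H) :
  closed_subspace H V -> orth_proj V (scal a x) = scal a (orth_proj V x).
Proof.
  intros CV. destruct (orth_proj_spec H V x CV) as [hx px].
  apply orth_proj_unique; [assumption | now apply closed_subspace_scal |].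
  intros z hz. specialize (px z hz). revert px.
  inner_simpl. intros. nra.
Qed.

Lemma pythagoras (H : hilbert) (V : H -> Prop) (x : H) :
  closed_subspace H V ->
  norm x ^ 2 = norm (orth_proj V x) ^ 2 + norm (minus x (orth_proj V x)) ^ 2.
Proof.
  intros CV. destruct (orth_proj_spec H V x CV) as [hx px].
  specialize (px _ hx). revert px. rewrite <- !inner_norm. inner_simpl.
  rewrite (inner_sym (orth_proj V x) x). intros. lra.
Qed.

Lemma norm_orth_proj_le (H : hilbert) (V : H -> Prop) (x : H) :
  closed_subspace H V -> norm (orth_proj V x) <= norm x.
Proof.
  intros CV. apply sq_le_le; [apply norm_nonneg|].
  rewrite (pythagoras H V x CV). assert (I := pow2_ge_0 (norm (minus x (orth_proj V x)))).
  lra.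
Qed.

Lemma norm_orth_compl_le (H : hilbert) (V : H -> Prop) (x : H) :
  closed_subspace H V -> norm (minus x (orth_proj V x)) <= norm x.
Proof.
  intros CV. apply sq_le_le; [apply norm_nonneg|].
  rewrite (pythagoras H V x CV). assert (I := pow2_ge_0 (norm (orth_proj V x))).
  lra.
Qed.

Lemma perp_perp (H : hilbert) (V : H -> Prop) (x : H) :
  closed_subspace H V -> perp H (perp H V) x -> V x.
Proof.
  intros CV hx. destruct (orth_proj_spec H V x CV) as [hp pp].
  assert (E := pythagoras H V x CV).
  assert (E2 := hx _ pp). specialize (pp _ hp).
  assert (N : norm (minus x (orth_proj V x)) = 0).
  { assert (I := inner_norm (minus x (orth_proj V x))).
    rewrite inner_minus in I. rewrite (inner_sym (orth_proj V x)), E2, pp in I. nra. }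
  apply eq_of_norm_minus in N. now rewrite N.
Qed.

(** * Closed linear spans *)

Lemma closed_subspace_closed_span (H : hilbert) (S : H -> Prop) :
  closed_subspace H (closed_span S).
Proof.
  assert (sp : forall (a : R) (x y : H), span S x -> span S y -> span S (plus (scal a x) y)).
  { intros a x y hx hy. induction hx as [|b u v hu hv IH].
    - replace (plus (scal a (zero : H)) y) with y by vec. assumption.
    - replace (plus (scal a (plus (scal b u) v)) y)
        with (plus (scal (a * b) u) (plus (scal a v) y)) by vec.
      now constructor. }
  split; [|split].
  - intros r hr. exists zero. split; [constructor|].
    now rewrite (norm_minus_self H zero).
  - intros a x y hx hy r hr.
    destruct (hx (r / 2 / (Rabs a + 1))) as [x' [hx' nx]].
    { assert (I := Rabs_pos a). apply Rdiv_lt_0_compat; lra. }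
    destruct (hy (r / 2)) as [y' [hy' ny]]; [lra|].
    exists (plus (scal a x') y'). split; [now apply sp|].
    apply Rle_lt_trans with (norm (plus (scal a (minus x x')) (minus y y'))).
    { right. f_equal. vec. }
    eapply Rle_lt_trans; [apply norm_axpy_le|].
    assert (I := Rabs_pos a). assert (N := norm_nonneg _ (minus x x')).
    apply (Rmult_lt_compat_l (Rabs a + 1)) in nx; [|lra].
    replace ((Rabs a + 1) * (r / 2 / (Rabs a + 1))) with (r / 2) in nx by (field; lra).
    nra.
  - intros x hx r hr. destruct (hx (r / 2)) as [y [hy ny]]; [lra|].
    destruct (hy (r / 2)) as [z [hz nz]]; [lra|]. exists z. split; [assumption|].
    assert (I := norm_triangle_minus _ x y z). lra.
Qed.

(** The induction principle for closed spans: a property that defines a closed subspace need only be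
    checked on the generators. *)
Lemma closed_span_incl (H : hilbert) (S V : H -> Prop) :
  closed_subspace H V -> (forall x, S x -> V x) ->
  forall x, closed_span S x -> V x.
Proof.
  intros CV SV x hx. apply CV. intros r hr.
  destruct (hx r hr) as [y [hy ny]]. exists y. split; [|assumption].
  clear -CV SV hy. induction hy as [|a u v hu hv IH]; [exact (proj1 CV)|].
  apply (proj1 (proj2 CV)); [now apply SV | assumption].
Qed.

Lemma closed_span_mem (H : hilbert) (S : H -> Prop) (x : H) :
  S x -> closed_span S x.
Proof.
  intros hx r hr. exists (plus (scal 1 x) zero). split; [now repeat constructor|].
  replace (plus (scal 1 x) zero) with x by vec. now rewrite norm_minus_self.
Qed.

(** * Resolvents of self-adjoint operators *)

Lemma self_adjoint_sym (H : hilbert) (A : operator H) (x y : H) :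
  self_adjoint A -> dom A x -> dom A y -> inner (A x) y = inner x (A y).
Proof.
  intros [_ [_ S]] hx hy. now apply (proj2 (S y (A y)) (conj hy eq_refl)).
Qed.

Lemma linear_operator_axpy (H : hilbert) (A : operator H) (a : R) (x y : H) :
  linear_operator A -> dom A x -> dom A y ->
  dom A (plus (scal a x) y) /\ A (plus (scal a x) y) = plus (scal a (A x)) (A y).
Proof.
  intros [_ [P S]] hx hy. destruct (S a x hx) as [h1 h2].
  destruct (P _ _ h1 hy) as [h3 h4]. split; [assumption|].
  rewrite h2 in h4. exact h4.
Qed.

Lemma linear_operator_minus (H : hilbert) (A : operator H) (x y : H) :
  linear_operator A -> dom A x -> dom A y ->
  dom A (minus x y) /\ A (minus x y) = minus (A x) (A y).
Proof.
  intros L hx hy. destruct (linear_operator_axpy H A (-1) y x L hy hx) as [h1 h2].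
  replace (minus x y) with (plus (scal (-1) y) x) by vec.
  split; [assumption|]. rewrite h2. vec.
Qed.

Lemma linear_operator_zero (H : hilbert) (A : operator H) :
  linear_operator A -> A zero = (zero : H).
Proof.
  intros [Z [_ S]]. destruct (S 0 _ Z) as [_ E].
  transitivity (A (scal 0 (zero : H))); [f_equal; vec|].
  transitivity (scal 0 (A zero)); [exact E | vec].
Qed.

(** Both [W] and its complement are invariant and the projection preserves the domain. For an
    unbounded operator the domain clause does not follow from invariance of [W]. *)
Definition reduces (H : hilbert) (A : operator H) (W : H -> Prop) : Prop :=
  forall x, dom A x ->
    dom A (orth_proj W x) /\ W (A (orth_proj W x)) /\
    perp H W (A (minus x (orth_proj W x))).

Lemma reduces_all (H : hilbert) (A : operator H) :
  linear_operator A -> reduces H A (@everywhere H).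
Proof.
  intros L x hx.
  assert (E : orth_proj (@everywhere H) x = x)
    by (apply orth_proj_of_mem; [apply closed_subspace_all | exact I]).
  rewrite E. split; [assumption|]. split; [exact I|].
  intros z _. destruct (linear_operator_minus H A x x L hx hx) as [_ h].
  rewrite h. inner_simpl. ring.
Qed.

(** Coercivity makes [A - l] bounded below on [W], so it is injective with closed range there. A
    vector of [W] orthogonal to the range is, by self-adjointness, an eigenvector for [l], which
    coercivity excludes. *)
Lemma resolvent_exists (H : hilbert) (A : operator H) (W : H -> Prop) (l c : R) :
  self_adjoint A -> closed_subspace H W -> reduces H A W -> 0 < c ->
  (forall w, W w -> dom A w -> (l + c) * norm w ^ 2 <= inner (A w) w) ->
  exists B, is_resolvent_on W A l B.
Proof.
  intros SA CW RW hc coer.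
  assert (LA : linear_operator A) by apply SA.
  set (D := fun w => minus (A w) (scal l w)).
  assert (low : forall w, W w -> dom A w -> c * norm w <= norm (D w)).
  { intros w hw dw. specialize (coer w hw dw).
    assert (I := cauchy_schwarz _ (D w) w).
    assert (I2 := Rle_abs (inner (D w) w)).
    assert (E : inner (D w) w = inner (A w) w - l * norm w ^ 2).
    { unfold D. inner_simpl. now rewrite inner_norm. }
    assert (N := norm_nonneg _ w). assert (N' := norm_nonneg _ (D w)).
    destruct (Req_dec (norm w) 0) as [Z|Z]; [rewrite Z; lra|].
    apply (Rmult_le_reg_r (norm w)); nra. }
  assert (lin : forall w1 w2, dom A w1 -> dom A w2 ->
            D (minus w1 w2) = minus (D w1) (D w2)).
  { intros w1 w2 h1 h2. unfold D.
    destruct (linear_operator_minus H A w1 w2 LA h1 h2) as [_ ->]. vec. }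
  set (Rg := fun y => exists w, W w /\ dom A w /\ D w = y).
  assert (CR : closed_subspace H Rg).
  { split; [|split].
    - exists zero. split; [exact (proj1 CW)|]. split; [apply LA|]. unfold D.
      rewrite (linear_operator_zero H A LA). vec.
    - intros a x y [w [hw [dw <-]]] [w' [hw' [dw' <-]]].
      exists (plus (scal a w) w').
      destruct (linear_operator_axpy H A a w w' LA dw dw') as [h1 h2].
      split; [now apply (proj1 (proj2 CW))|]. split; [assumption|].
      unfold D. rewrite h2. vec.
    - intros y hy.
      destruct (cauchy_family H
        (fun r w => W w /\ dom A w /\ norm (minus y (D w)) < r)) as [w hw].
      + intros r hr. destruct (hy r hr) as [z [[w [hw [dw <-]]] nz]].
        exists w. auto.
      + intros r s w hr [hw [dw n]]. split; [assumption|]. split; [assumption|]. lra.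
      + intros e he. exists (c * e / 2). split; [nra|].
        intros w1 w2 [h1 [d1 n1]] [h2 [d2 n2]].
        assert (I := low (minus w1 w2) (closed_subspace_minus H W w1 w2 CW h1 h2)
          (proj1 (linear_operator_minus H A w1 w2 LA d1 d2))).
        rewrite (lin w1 w2 d1 d2) in I.
        assert (I2 := norm_triangle_minus _ (D w1) y (D w2)).
        rewrite (norm_minus_sym _ (D w1) y) in I2.
        apply (Rmult_lt_reg_l c); nra.
      + assert (hww : W w).
        { apply CW. intros r hr. destruct (hw r hr) as [s [hs h]].
          destruct (hy s hs) as [z [[w' [hw' [dw' <-]]] nz]].
          exists w'. split; [assumption|]. rewrite norm_minus_sym. now apply h. }
        (* Closedness of the graph: the relation defining the adjoint passes to the limit [w], and
           self-adjointness turns it back into membership in the domain. *)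
        assert (G : dom A w /\ A w = plus y (scal l w)).
        { apply SA. intros x hx. apply Rminus_diag_uniq.
          apply (small_zero _ (norm (A x) + norm x * (1 + Rabs l))).
          intros e he _. destruct (hw e he) as [s [hs h]].
          assert (hm : 0 < Rmin s e) by now apply Rmin_pos.
          destruct (hy _ hm) as [z [[w' [hw' [dw' <-]]] nz]].
          assert (I1 := Rmin_l s e). assert (I2 := Rmin_r s e).
          assert (n1 : norm (minus w' w) < e).
          { apply h. split; [assumption|]. split; [assumption|]. lra. }
          assert (S := self_adjoint_sym H A x w' SA hx dw').
          replace (inner (A x) w - inner x (plus y (scal l w))) with
            (- inner (A x) (minus w' w) - inner x (minus y (D w'))
             + l * inner x (minus w' w))
            by (unfold D; inner_simpl; rewrite S; ring).
          assert (c1 := cauchy_schwarz _ (A x) (minus w' w)).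
          assert (c2 := cauchy_schwarz _ x (minus y (D w'))).
          assert (c3 := cauchy_schwarz _ x (minus w' w)).
          assert (P1 := norm_nonneg _ (A x)). assert (P2 := norm_nonneg _ x).
          assert (P3 := Rabs_pos l).
          eapply Rle_trans; [apply Rabs_triang|]. rewrite Rabs_mult.
          assert (T := Rabs_triang (- inner (A x) (minus w' w)) (- inner x (minus y (D w')))).
          rewrite !Rabs_Ropp in T.
          assert (b1 : norm (A x) * norm (minus w' w) <= norm (A x) * e)
            by (apply Rmult_le_compat_l; lra).
          assert (b2 : norm x * norm (minus y (D w')) <= norm x * e)
            by (apply Rmult_le_compat_l; lra).
          assert (b3 : norm x * norm (minus w' w) <= norm x * e)
            by (apply Rmult_le_compat_l; lra).
          assert (b4 : Rabs l * Rabs (inner x (minus w' w)) <= Rabs l * (norm x * e))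
            by (apply Rmult_le_compat_l; lra).
          unfold Rminus at 1. lra. }
        exists w. split; [assumption|]. split; [apply G|].
        unfold D. rewrite (proj2 G). vec. }
  assert (RgW : forall y, Rg y -> W y).
  { intros y [w [hw [dw <-]]]. apply closed_subspace_minus; [assumption| |].
    - destruct (RW w dw) as [_ [h _]].
      now rewrite (orth_proj_of_mem H W w CW hw) in h.
    - now apply closed_subspace_scal. }
  assert (onto : forall y, W y -> Rg y).
  { intros y hy. destruct (orth_proj_spec H Rg y CR) as [hp pp].
    set (p := orth_proj Rg y) in *.
    assert (hz : W (minus y p)).
    { apply closed_subspace_minus; [assumption | assumption | now apply RgW]. }
    (* A test vector [x] splits along [W]: its [W] part is paired through orthogonality to the
       range, and its other part contributes nothing because [W] reduces [A]. *)
    assert (G : dom A (minus y p) /\ A (minus y p) = scal l (minus y p)).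
    { apply SA. intros x hx. destruct (RW x hx) as [d1 [h1 h2]].
      destruct (orth_proj_spec H W x CW) as [k1 k2].
      specialize (h2 _ hz). specialize (k2 _ hz).
      destruct (linear_operator_minus H A x _ LA hx d1) as [_ E]. rewrite E in h2.
      assert (k3 : inner (minus y p) (D (orth_proj W x)) = 0).
      { apply pp. exists (orth_proj W x). auto. }
      rewrite inner_sym in k3. unfold D in k3.
      rewrite inner_minus, inner_scal in k3. rewrite inner_minus in h2, k2.
      rewrite inner_scal_r. nra. }
    assert (I := coer _ hz (proj1 G)). rewrite (proj2 G), inner_scal, inner_norm in I.
    assert (E : norm (minus y p) = 0).
    { assert (N := norm_nonneg _ (minus y p)).
      assert (norm (minus y p) ^ 2 <= 0)
        by (apply (Rmult_le_reg_l c); [assumption | lra]).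
      nra. }
    apply eq_of_norm_minus in E. now rewrite E. }
  destruct (functional_choice (fun y w => W y -> W w /\ dom A w /\ D w = y)) as [B hB].
  { intros y. destruct (classic (W y)) as [hy|hy].
    - destruct (onto y hy) as [w hw]. now exists w.
    - exists y. tauto. }
  exists B. split; [exact hB|]. split.
  - intros x hx dx. assert (h : Rg (D x)) by (exists x; auto).
    split; [now apply RgW|]. destruct (hB (D x) (RgW _ h)) as [h1 [h2 h3]].
    fold (D x). apply eq_of_norm_minus.
    assert (I := low (minus (B (D x)) x) (closed_subspace_minus H W _ _ CW h1 hx)
       (proj1 (linear_operator_minus H A _ _ LA h2 dx))).
    rewrite lin, h3, norm_minus_self in I by assumption.
    assert (N := norm_nonneg _ (minus (B (D x)) x)). nra.
  - exists (/ c). intros y hy. destruct (hB y hy) as [h1 [h2 h3]].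
    assert (I := low _ h1 h2). rewrite h3 in I.
    apply (Rmult_le_reg_l c); [assumption|].
    replace (c * (/ c * norm y)) with (norm y) by (field; lra). exact I.
Qed.

(** * The spectral gap above the low modes *)

Lemma filterlim_norm_lt (H : hilbert) (T : Type) (F : (T -> Prop) -> Prop)
    (u : T -> H) (y : H) : Filter F ->
  (filterlim u F (locally y) <->
   forall e, 0 < e -> F (fun n => norm (minus (u n) y) < e)).
Proof.
  intros FF. split.
  - intros h e he.
    exact (proj1 (filterlim_locally_ball_norm (F := F) u y) h (mkposreal e he)).
  - intros h. apply (proj2 (filterlim_locally_ball_norm (F := F) u y)).
    intros e. exact (h e (cond_pos e)).
Qed.

Lemma extraction_ge (phi : nat -> nat) :
  (forall n, (phi n < phi (S n))%nat) -> forall n, (n <= phi n)%nat.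
Proof.
  intros h n. induction n as [|n IH]; [lia|]. specialize (h n). lia.
Qed.

Lemma perp_closed_span (H : hilbert) (S : H -> Prop) (x : H) :
  (forall e, S e -> inner x e = 0) -> perp H (closed_span S) x.
Proof.
  intros h z hz.
  assert (P : perp H (fun y => y = x) z).
  { revert hz. apply closed_span_incl; [apply closed_subspace_perp|].
    intros e he y ->. rewrite inner_sym. now apply h. }
  rewrite inner_sym. now apply P.
Qed.

Lemma resolvent_linear (H : hilbert) (A : operator H) (l : R) (B : H -> H) :
  linear_operator A -> is_resolvent_on (@everywhere H) A l B ->
  forall (a : R) (x y : H), B (plus (scal a x) y) = plus (scal a (B x)) (B y).
Proof.
  intros LA [h1 [h2 _]] a x y.
  destruct (h1 x I) as [_ [dx ex]]. destruct (h1 y I) as [_ [dy ey]].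
  destruct (linear_operator_axpy H A a _ _ LA dx dy) as [d E].
  destruct (h2 _ I d) as [_ E2]. refine (eq_trans _ E2). f_equal.
  refine (eq_trans _ (f_equal (fun v => minus v _) (eq_sym E))).
  transitivity (plus (scal a (minus (A (B x)) (scal l (B x))))
                  (minus (A (B y)) (scal l (B y)))); [now rewrite ex, ey | vec].
Qed.

(** Since [A >= 0], the point -1 lies below the spectrum and [T = (A + 1)^-1] is a positive
    contraction. The inequality [norm (T x) ^ 2 <= inner (T x) x] is the nonnegativity of [A] tested
    at [T x]. *)
Lemma resolvent_minus_one (H : hilbert) (A : operator H) :
  self_adjoint A -> bounded_below A 0 -> compact_resolvent A ->
  exists T : H -> H,
    (forall x : H, dom A (T x) /\ plus (A (T x)) (T x) = x) /\
    (forall x : H, dom A x -> T (plus (A x) x) = x) /\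
    (forall (a : R) (x y : H), T (plus (scal a x) y) = plus (scal a (T x)) (T y)) /\
    (forall x y : H, inner (T x) y = inner x (T y)) /\
    (forall x : H, norm (T x) ^ 2 <= inner (T x) x) /\
    (forall x : H, norm (T x) <= norm x) /\
    compact_map T.
Proof.
  intros SA BA [l0 [B [RB CB]]].
  assert (LA : linear_operator A) by apply SA.
  destruct (resolvent_exists H A (@everywhere H) (-1) 1) as [T RT];
    [assumption | apply closed_subspace_all | now apply reduces_all | lra | |].
  { intros w _ dw. specialize (BA w dw). lra. }
  exists T.
  assert (T1 : forall x, dom A (T x) /\ plus (A (T x)) (T x) = x).
  { intros x. destruct RT as [h _]. destruct (h x I) as [_ [d E]].
    split; [assumption|].
    transitivity (minus (A (T x)) (scal (-1) (T x))); [vec | assumption]. }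
  assert (T2 : forall x, dom A x -> T (plus (A x) x) = x).
  { intros x dx. destruct RT as [_ [h _]]. destruct (h x I dx) as [_ E].
    transitivity (T (minus (A x) (scal (-1) x))); [f_equal; vec | assumption]. }
  assert (TL := resolvent_linear H A (-1) T LA RT).
  assert (TS : forall x y, inner (T x) y = inner x (T y)).
  { intros x y. destruct (T1 x) as [dx ex]. destruct (T1 y) as [dy ey].
    transitivity (inner (T x) (plus (A (T y)) (T y))); [now rewrite ey|].
    transitivity (inner (plus (A (T x)) (T x)) (T y)); [|now rewrite ex].
    inner_simpl. rewrite (self_adjoint_sym H A _ _ SA dx dy). ring. }
  assert (TP : forall x, norm (T x) ^ 2 <= inner (T x) x).
  { intros x. destruct (T1 x) as [dx ex]. specialize (BA _ dx).
    assert (E : inner (T x) (plus (A (T x)) (T x)) = inner (T x) x) by now rewrite ex.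
    rewrite inner_plus_r, inner_norm, (inner_sym (T x)) in E. lra. }
  assert (TB : forall x, norm (T x) <= norm x).
  { intros x. assert (I1 := TP x). assert (I2 := cauchy_schwarz _ (T x) x).
    assert (I3 := Rle_abs (inner (T x) x)).
    assert (N := norm_nonneg _ (T x)). assert (N2 := norm_nonneg _ x).
    destruct (Req_dec (norm (T x)) 0) as [Z|Z]; [lra|].
    apply (Rmult_le_reg_l (norm (T x))); nra. }
  split; [assumption|]. split; [assumption|]. split; [assumption|].
  split; [assumption|]. split; [assumption|]. split; [assumption|].
  intros x [M hM].
  (* The resolvent identity carries compactness from the unspecified point [l0] to -1. *)
  assert (TBE : forall y, T y = B (minus y (scal (1 + l0) (T y)))).
  { intros y. destruct (T1 y) as [dy ey]. destruct RB as [_ [h _]].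
    destruct (h (T y) I dy) as [_ E]. rewrite <- E at 1. f_equal.
    transitivity (minus (plus (A (T y)) (T y)) (scal (1 + l0) (T y))); [vec|].
    now rewrite ey. }
  destruct (CB (fun n => minus (x n) (scal (1 + l0) (T (x n))))) as [phi [y [h1 h2]]].
  { exists (M + Rabs (1 + l0) * M). intros n.
    eapply Rle_trans; [apply norm_minus_le|]. rewrite norm_scal_eq.
    specialize (hM n). assert (I1 := TB (x n)). assert (I2 := Rabs_pos (1 + l0)).
    assert (Rabs (1 + l0) * norm (T (x n)) <= Rabs (1 + l0) * M)
      by (apply Rmult_le_compat_l; lra). lra. }
  exists phi, y. split; [assumption|].
  eapply filterlim_ext; [|exact h2]. intros n. simpl. now rewrite <- TBE.
Qed.

Lemma axpy_scal (H : hilbert) (T : H -> H) :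
  (forall (a : R) (x y : H), T (plus (scal a x) y) = plus (scal a (T x)) (T y)) ->
  forall (a : R) (x : H), T (scal a x) = scal a (T x).
Proof.
  intros TL a x. assert (Z : T zero = (zero : H)).
  { refine (eq_trans _ (eq_trans (TL (-1) zero zero) _)); [f_equal; vec | vec]. }
  refine (eq_trans _ (eq_trans (TL a x zero) _)); [f_equal; vec|].
  rewrite Z. vec.
Qed.

(* With m the supremum of the Rayleigh quotient,
   |T x - m x|^2 <= m (m - <T x, x>) for unit x in W, so a maximizing sequence
   consists of approximate eigenvectors. *)
Lemma top_eigenvector (H : hilbert) (T : H -> H) (W : H -> Prop) :
  (forall (a : R) (x y : H), T (plus (scal a x) y) = plus (scal a (T x)) (T y)) ->
  (forall x y : H, inner (T x) y = inner x (T y)) ->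
  (forall x : H, norm (T x) ^ 2 <= inner (T x) x) ->
  (forall x : H, norm (T x) <= norm x) ->
  (forall x : H, T x = zero -> x = zero) ->
  compact_map T ->
  closed_subspace H W -> (forall x : H, W x -> W (T x)) ->
  (exists x, W x /\ x <> zero) ->
  exists m y, 0 < m /\ W y /\ y <> zero /\ T y = scal m y /\
    forall x, W x -> norm (T x) ^ 2 <= m * inner (T x) x.
Proof.
  intros TL TS TP TB TI TC CW TW [x0 [hx0 nx0]].
  assert (Tscal := axpy_scal H T TL).
  set (S := fun r => exists x, W x /\ norm x <= 1 /\ r = inner (T x) x).
  destruct (completeness S) as [m [ub lub]].
  { exists 1. intros r [x [hx [nx ->]]]. assert (I1 := cauchy_schwarz _ (T x) x).
    assert (I2 := Rle_abs (inner (T x) x)). assert (I3 := TB x).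
    assert (N := norm_nonneg _ x). assert (N2 := norm_nonneg _ (T x)). nra. }
  { exists (inner (T zero) zero), zero. split; [exact (proj1 CW)|].
    split; [rewrite norm_zero_eq; lra | reflexivity]. }
  assert (hom : forall x, W x -> inner (T x) x <= m * norm x ^ 2).
  { intros x hx. assert (N := norm_nonneg _ x).
    destruct (Req_dec (norm x) 0) as [Z|Z].
    - rewrite (norm_eq_0 _ _ Z), inner_zero_r, norm_zero_eq. lra.
    - assert (I1 : S (inner (T (scal (/ norm x) x)) (scal (/ norm x) x))).
      { exists (scal (/ norm x) x). split; [now apply closed_subspace_scal|].
        split; [|reflexivity]. rewrite norm_scal_eq, Rabs_right.
        - right. now field.
        - left. apply Rinv_0_lt_compat. lra. }
      apply ub in I1. rewrite Tscal, inner_scal, inner_scal_r in I1.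
      apply (Rmult_le_compat_r (norm x ^ 2)) in I1; [|apply pow2_ge_0].
      replace (/ norm x * (/ norm x * inner (T x) x) * norm x ^ 2)
        with (inner (T x) x) in I1 by now field.
      assumption. }
  assert (hm : 0 < m).
  { assert (P1 : 0 < norm (T x0) ^ 2).
    { assert (N := norm_nonneg _ (T x0)).
      destruct (Req_dec (norm (T x0)) 0) as [Z|Z]; [|nra].
      exfalso. apply nx0, TI, norm_eq_0, Z. }
    assert (I1 := TP x0). assert (I2 := hom x0 hx0).
    assert (N := pow2_ge_0 (norm x0)). nra. }
  (* Positivity of [T] at [z = x - T x / m] gives [2 norm (T x) ^ 2 <= m <T x, x> + <T (T x), T x> /
     m], and the last term is at most [norm (T x) ^ 2] by [hom]. *)
  assert (key : forall x, W x -> norm (T x) ^ 2 <= m * inner (T x) x).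
  { intros x hx. set (z := plus (scal (- / m) (T x)) x).
    assert (E : inner (T z) z = inner (T x) x - 2 / m * norm (T x) ^ 2
                 + / m ^ 2 * inner (T (T x)) (T x)).
    { unfold z. rewrite TL, <- inner_norm. inner_simpl.
      rewrite (TS (T x) x). field. lra. }
    assert (I1 := TP z). assert (I2 := pow2_ge_0 (norm (T z))).
    assert (I3 := hom (T x) (TW x hx)).
    assert (I4 : 0 <= m * inner (T z) z) by (apply Rmult_le_pos; lra).
    assert (E2 : m * inner (T z) z = m * inner (T x) x - 2 * norm (T x) ^ 2
      + / m * inner (T (T x)) (T x)) by (rewrite E; field; lra).
    apply (Rmult_le_compat_l (/ m)) in I3;
      [|left; now apply Rinv_0_lt_compat].
    replace (/ m * (m * norm (T x) ^ 2)) with (norm (T x) ^ 2) in I3 by (field; lra).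
    lra. }
  assert (ex : forall n : nat, exists x,
     W x /\ norm x <= 1 /\ m - / INR (n + 1) <= inner (T x) x).
  { intros n. apply NNPP. intros no.
    assert (pn : 0 < / INR (n + 1)) by (apply Rinv_0_lt_compat, lt_0_INR; lia).
    assert (m <= m - / INR (n + 1)); [|lra]. apply lub. intros r [x [hx [nx ->]]].
    destruct (Rle_lt_dec (inner (T x) x) (m - / INR (n + 1))); [assumption|].
    exfalso. apply no. exists x. repeat split; [assumption..|]. lra. }
  destruct (functional_choice _ ex) as [x hx].
  destruct (TC x) as [phi [y [inc lim]]]; [exists 1; intros n; apply hx|].
  rewrite filterlim_norm_lt in lim by apply eventually_filter.
  assert (app : forall e, 0 < e -> exists n, norm (minus (T (x n)) y) < e /\
            m - e <= inner (T (x n)) (x n)).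
  { intros e he. destruct (lim e he) as [N hN].
    destruct (nfloor_ex (/ e)) as [k [_ hk]]; [left; now apply Rinv_0_lt_compat|].
    exists (phi (N + k)%nat). split; [apply hN; lia|].
    assert (G := extraction_ge phi inc (N + k)).
    destruct (hx (phi (N + k)%nat)) as [_ [_ h]].
    assert (L : / INR (phi (N + k)%nat + 1) <= e); [|lra].
    rewrite <- (Rinv_inv e). apply Rinv_le_contravar; [now apply Rinv_0_lt_compat|].
    assert (INR k + 1 <= INR (phi (N + k)%nat + 1)); [|lra].
    rewrite <- S_INR. apply le_INR. lia. }
  exists m, y. split; [assumption|].
  assert (hy : W y).
  { apply CW. intros r hr. destruct (app r hr) as [n [h _]].
    exists (T (x n)). split; [apply TW, hx|]. now rewrite norm_minus_sym. }
  split; [assumption|]. split; [|split; [|assumption]].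
  (* If the limit were 0, then [norm (T (x n)) < m / 4], while an almost maximal quotient forces it
     to be at least [3 m / 4]. *)
  - intros ->. destruct (app (m / 4)) as [n [h1 h2]]; [lra|].
    destruct (hx n) as [_ [nx _]].
    assert (I1 := cauchy_schwarz _ (T (x n)) (x n)).
    assert (I2 := Rle_abs (inner (T (x n)) (x n))).
    assert (I3 := norm_le_minus _ (T (x n)) zero). rewrite norm_zero_eq in I3.
    assert (N := norm_nonneg _ (x n)). assert (N2 := norm_nonneg _ (T (x n))). nra.
  - apply eq_of_norm_minus.
    assert (Q : norm (minus (T y) (scal m y)) ^ 2 = 0); [|nra].
    (* The constant comes from [(a + b + c) ^ 2 <= 3 (a ^ 2 + b ^ 2 + c ^ 2)], the three squares
       being at most [m ^ 2 e], [m e] and [e]. *)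
    apply (small_zero _ (3 * (1 + m + m ^ 2))). intros e he he1.
    destruct (app e he) as [n [h1 h2]]. destruct (hx n) as [hW [nx _]].
    set (d := minus (T (x n)) y) in *.
    set (q := minus (T (x n)) (scal m (x n))).
    assert (hq : norm q ^ 2 <= m * e).
    { unfold q. rewrite norm_minus_sq, norm_scal_eq, inner_scal_r, Rabs_right by lra.
      assert (K := key _ hW). assert (N := norm_nonneg _ (x n)).
      assert (norm (x n) ^ 2 <= 1) by nra. assert (0 < m ^ 2) by nra. nra. }
    (* The defect at the limit is expressed by the two small quantities [d], the distance from
       [T (x n)] to [y], and [q], the defect at [x n]. *)
    assert (E : minus (T y) (scal m y) = plus (scal m d) (minus (T q) (T d))).
    { unfold q, d.
      assert (E1 : T (minus (T (x n)) y) = minus (T (T (x n))) (T y)).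
      { transitivity (T (plus (scal (-1) y) (T (x n)))); [f_equal; vec|].
        rewrite TL. vec. }
      assert (E2 : T (minus (T (x n)) (scal m (x n)))
                 = minus (T (T (x n))) (scal m (T (x n)))).
      { transitivity (T (plus (scal (- m) (x n)) (T (x n)))); [f_equal; vec|].
        rewrite TL. vec. }
      rewrite E1, E2. vec. }
    assert (B : norm (minus (T y) (scal m y)) <= m * e + norm q + e).
    { rewrite E. eapply Rle_trans; [apply norm_axpy_le|].
      rewrite Rabs_right by lra.
      assert (I1 := norm_minus_le _ (T q) (T d)).
      assert (I2 := TB q). assert (I3 := TB d).
      assert (m * norm d <= m * e) by (apply Rmult_le_compat_l; lra). lra. }
    assert (N := norm_nonneg _ (minus (T y) (scal m y))).
    assert (N2 := norm_nonneg _ q).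
    rewrite Rabs_right by nra.
    apply Rle_trans with ((m * e + norm q + e) ^ 2); [nra|].
    apply Rle_trans with (3 * ((m * e) ^ 2 + norm q ^ 2 + e ^ 2)).
    + assert (0 <= (m * e - norm q) ^ 2) by apply pow2_ge_0.
      assert (0 <= (m * e - e) ^ 2) by apply pow2_ge_0.
      assert (0 <= (norm q - e) ^ 2) by apply pow2_ge_0. lra.
    + assert (e ^ 2 <= e) by nra.
      assert ((m * e) ^ 2 <= m ^ 2 * e).
      { rewrite Rpow_mult_distr. apply Rmult_le_compat_l; [apply pow2_ge_0 | assumption]. }
      lra.
Qed.


(** The top eigenvalue [m] of [T = (A + 1)^-1] on [W] is the bottom eigenvalue [/ m - 1] of [A]
    there, and membership in [W] forces it above [L]. The last clause makes the spectrum on [W]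
    nonempty, so that its infimum is not the default value of [real]. *)
Lemma spectral_gap (H : hilbert) (A : operator H) (L : R) :
  self_adjoint A -> bounded_below A 0 -> compact_resolvent A ->
  let W := perp H (closed_span
             (fun x => exists l, 0 <= l <= L /\ dom A x /\ A x = scal l x)) in
  reduces H A W /\
  (forall w, W w -> dom A w -> L * norm w ^ 2 <= inner (A w) w) /\
  ((exists w, W w /\ w <> zero) -> exists l, spectrum_on W A l).
Proof.
  intros SA BA CA.
  assert (LA : linear_operator A) by apply SA.
  destruct (resolvent_minus_one H A SA BA CA) as [T [T1 [T2 [TL [TS [TP [TB TC]]]]]]].
  set (S := fun x => exists l, 0 <= l <= L /\ dom A x /\ A x = scal l x).
  set (V := closed_span S). intros W.
  assert (CV : closed_subspace H V) by apply closed_subspace_closed_span.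
  assert (CW : closed_subspace H W) by apply closed_subspace_perp.
  assert (Tmin : forall x y, T (minus x y) = minus (T x) (T y)).
  { intros x y. transitivity (T (plus (scal (-1) y) x)); [f_equal; vec|].
    rewrite TL. vec. }
  assert (TI : forall x, T x = zero -> x = zero).
  { intros x hx. destruct (T1 x) as [_ E]. rewrite hx, (linear_operator_zero H A LA) in E.
    rewrite <- E. vec. }
  (* Eigenvectors of [A] are eigenvectors of the bounded [T], so [T] preserves their closed span
     and, by symmetry, the complement. *)
  assert (Teig : forall l x, 0 <= l -> dom A x -> A x = scal l x ->
            x = scal (l + 1) (T x)).
  { intros l x hl dx ex. assert (E := T2 x dx). rewrite ex in E.
    transitivity (T (plus (scal l x) x)); [now symmetry|]. rewrite TL. vec. }
  assert (TW : forall x, W x -> W (T x)).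
  { intros x hx. apply perp_closed_span. intros e he.
    assert (hV : V e) by now apply closed_span_mem.
    destruct he as [l [hl [de ee]]].
    assert (E := hx e hV). rewrite (Teig l e (proj1 hl) de ee), inner_scal_r in E.
    rewrite TS. nra. }
  assert (TV : forall x, V x -> V (T x)).
  { intros x hx. apply perp_perp; [assumption|]. intros w hw.
    rewrite TS, inner_sym. now apply (TW w hw). }
  assert (ATx : forall x, A (T x) = minus x (T x)).
  { intros x. destruct (T1 x) as [_ E]. rewrite <- E at 2. vec. }
  (* A domain vector is [T y] with [y = A x + x], and the projection commutes with [T]; hence the
     projection of [x] is [T] of a vector and stays in the domain. *)
  assert (RW : reduces H A W).
  { intros x dx. set (y := plus (A x) x).
    assert (Ty : T y = x) by now apply T2.
    destruct (orth_proj_spec H W y CW) as [hp pp].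
    assert (hV : V (minus y (orth_proj W y))) by now apply perp_perp.
    assert (E : orth_proj W x = T (orth_proj W y)).
    { apply orth_proj_unique; [assumption | now apply TW |].
      rewrite <- Ty, <- Tmin. intros z hz. rewrite inner_sym. now apply hz, TV. }
    rewrite E. split; [apply T1|]. split.
    - rewrite ATx. apply closed_subspace_minus; [assumption | assumption | now apply TW].
    - rewrite <- Ty, <- Tmin, ATx. intros z hz. rewrite inner_sym.
      apply hz. apply closed_subspace_minus; [assumption | assumption | now apply TV]. }
  assert (top : (exists w, W w /\ w <> zero) -> exists l y, L < l /\ W y /\ y <> zero /\
     dom A y /\ A y = scal l y /\
     forall w, W w -> dom A w -> l * norm w ^ 2 <= inner (A w) w).
  { intros ex.
    destruct (top_eigenvector H T W TL TS TP TB TI TC CW TW ex)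
      as [m [y [hm [hy [ny [ey key]]]]]].
    assert (mi : 0 < / m) by now apply Rinv_0_lt_compat.
    assert (Ey : y = T (scal (/ m) y)).
    { transitivity (scal (/ m) (T y)).
      - rewrite ey. apply inner_ext. intros w. inner_simpl. field. lra.
      - symmetry. apply (axpy_scal H T TL). }
    assert (dy : dom A y) by (rewrite Ey; apply T1).
    assert (Ay : A y = scal (/ m - 1) y).
    { transitivity (A (T (scal (/ m) y))); [now rewrite <- Ey|].
      rewrite ATx, <- Ey. vec. }
    exists (/ m - 1), y. split; [|split; [|split; [|split; [|split]]]]; try assumption.
    - apply Rnot_le_lt. intros le.
      assert (Ip := BA y dy). rewrite Ay, inner_scal, inner_norm in Ip.
      assert (P : 0 < norm y ^ 2).
      { assert (N := norm_nonneg _ y). destruct (Req_dec (norm y) 0) as [Z|Z]; [|nra].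
        exfalso. apply ny, norm_eq_0, Z. }
      assert (hl : 0 <= / m - 1) by nra.
      assert (hV : V y).
      { apply closed_span_mem. exists (/ m - 1). repeat split; assumption. }
      assert (Z := hy y hV). rewrite inner_norm in Z. lra.
    - intros w hw dw. set (x := plus (A w) w).
      assert (hx : W x).
      { apply closed_subspace_plus; [assumption | | assumption].
        destruct (RW w dw) as [_ [h _]].
        now rewrite (orth_proj_of_mem H W w CW hw) in h. }
      (* With [x = (A + 1) w] and [T x = w], the inequality for [T] reads
         [norm w ^ 2 <= m (<A w, w> + norm w ^ 2)]. *)
      assert (K := key x hx). unfold x in K. rewrite (T2 w dw) in K.
      rewrite inner_plus_r, inner_norm, (inner_sym w) in K.
      apply (Rmult_le_compat_l (/ m)) in K; [|lra].
      replace (/ m * (m * (inner (A w) w + norm w ^ 2)))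
        with (inner (A w) w + norm w ^ 2) in K by (field; lra). lra. }
  split; [assumption|]. split.
  - intros w hw dw. destruct (classic (w = zero)) as [->|nz].
    + rewrite norm_zero_eq, inner_zero_r. lra.
    + destruct top as [l [y [hl [_ [_ [_ [_ h]]]]]]]; [now exists w|].
      specialize (h w hw dw). assert (N := pow2_ge_0 (norm w)). nra.
  - intros ex. destruct (top ex) as [l [y [hl [hy [ny [dy [ey _]]]]]]].
    exists l. intros [B [_ [h2 [M h3]]]]. apply ny.
    destruct (h2 y hy dy) as [_ E].
    assert (Z : minus (A y) (scal l y) = (zero : H)) by (rewrite ey; vec).
    rewrite Z in E. assert (I1 := h3 zero (proj1 CW)).
    rewrite E, norm_zero_eq in I1. apply norm_eq_0.
    assert (N := norm_nonneg _ y). lra.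
Qed.

(** * Continuity of semigroups *)

Lemma linear_minus_H (H : hilbert) (T : H -> H) (x y : H) :
  is_linear T -> T (minus x y) = minus (T x) (T y).
Proof. exact (linear_minus T x y). Qed.

Lemma linear_scal_H (H : hilbert) (T : H -> H) (a : R) (x : H) :
  is_linear T -> T (scal a x) = scal a (T x).
Proof. intros [_ S _]. exact (S a x). Qed.

Lemma linear_plus_H (H : hilbert) (T : H -> H) (x y : H) :
  is_linear T -> T (plus x y) = plus (T x) (T y).
Proof. intros [P _ _]. exact (P x y). Qed.

Lemma linear_bound (H : hilbert) (T : H -> H) :
  is_linear T -> exists M, 0 < M /\ forall x : H, norm (T x) <= M * norm x.
Proof. intros [_ _ B]. exact B. Qed.

(* Unboundedness lets every ball be shrunk to a smaller one on which some T n
   exceeds k; a point common to all of them contradicts pointwise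
   boundedness. *)
Lemma uniform_boundedness (H : hilbert) (T : nat -> H -> H) :
  (forall n, is_linear (T n)) ->
  (forall x : H, exists M, forall n, norm (T n x) <= M) ->
  exists M, forall n (x : H), norm (T n x) <= M * norm x.
Proof.
  intros TL PB. apply NNPP. intros no.
  assert (unb : forall M, exists n (x : H), M * norm x < norm (T n x)).
  { intros M. apply NNPP. intros no2. apply no. exists M. intros n x.
    apply Rnot_lt_le. intros lt. apply no2. now exists n, x. }
  assert (step : forall k (x : H) r, 0 < r -> exists (x' : H) r',
    0 < r' /\ r' <= r / 2 /\ norm (minus x' x) <= r / 2 /\
    forall z : H, norm (minus z x') <= r' -> exists n, INR k < norm (T n z)).
  { intros k x r hr. destruct (unb (2 * (INR k + 2) / r)) as [n [y0 hy0]].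
    assert (Ny := norm_nonneg _ y0). assert (pk := pos_INR k).
    destruct (linear_bound H (T n) (TL n)) as [Mn [pMn hMn]].
    assert (py : 0 < norm y0).
    { destruct (Req_dec (norm y0) 0) as [Z|Z]; [|lra].
      assert (I1 := hMn y0). rewrite Z in I1, hy0. lra. }
    set (y := scal (r / 2 / norm y0) y0).
    assert (pc : 0 < r / 2 / norm y0) by (apply Rdiv_lt_0_compat; lra).
    assert (ny : norm y = r / 2).
    { unfold y. rewrite norm_scal_eq, Rabs_right by lra. field. lra. }
    assert (Ty : INR k + 2 < norm (T n y)).
    { unfold y. rewrite (linear_scal_H H (T n) _ _ (TL n)), norm_scal_eq, Rabs_right by lra.
      apply (Rmult_lt_compat_l (r / 2 / norm y0)) in hy0; [|assumption].
      replace (r / 2 / norm y0 * (2 * (INR k + 2) / r * norm y0)) with (INR k + 2)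
        in hy0 by (field; lra). exact hy0. }
    (* One of [x + y] and [x - y] must have a large image, since the difference of the two images is
       [2 T y]. *)
    assert (ex : exists x', norm (minus x' x) = r / 2 /\ INR k + 2 < norm (T n x')).
    { destruct (Rlt_le_dec (INR k + 2) (norm (T n (plus x y)))) as [h|h].
      - exists (plus x y). split; [|assumption]. rewrite <- ny.
        f_equal. vec.
      - exists (minus x y). split.
        + rewrite <- ny, <- (Rmult_1_l (norm y)), <- Rabs_R1, <- (Rabs_Ropp 1),
            <- norm_scal_eq. f_equal. vec.
        + apply Rnot_le_lt. intros h'.
          rewrite (linear_plus_H H (T n) _ _ (TL n)) in h.
          rewrite (linear_minus_H H (T n) _ _ (TL n)) in h'.
          assert (E : norm (scal 2 (T n y)) =
            norm (minus (plus (T n x) (T n y)) (minus (T n x) (T n y))))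
            by (f_equal; vec).
          rewrite norm_scal_eq, Rabs_right in E by lra.
          assert (I1 := norm_minus_le _ (plus (T n x) (T n y)) (minus (T n x) (T n y))).
          lra. }
    destruct ex as [x' [hx' Tx']].
    (* The radius [/ Mn] costs at most 1 of the margin [k + 2] over the whole new ball. *)
    exists x', (Rmin (r / 2) (/ Mn)).
    assert (pi : 0 < / Mn) by now apply Rinv_0_lt_compat.
    split; [apply Rmin_pos; lra|]. split; [apply Rmin_l|]. split; [lra|].
    intros z hz. exists n.
    assert (I1 := norm_le_minus _ (T n x') (T n z)).
    rewrite norm_minus_sym, <- (linear_minus_H H (T n) _ _ (TL n)) in I1.
    assert (I2 := hMn (minus z x')). assert (I3 := Rmin_r (r / 2) (/ Mn)).
    assert (I4 : Mn * norm (minus z x') <= Mn * / Mn)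
      by (apply Rmult_le_compat_l; lra).
    rewrite Rinv_r in I4 by lra. lra. }
  (* Dependent choice of the balls: the step index is part of the state, and the implication from
     [0 < r] makes the relation total. *)
  destruct (functional_choice (fun (s : nat * (H * R)) (s' : H * R) =>
    let '(k, (x, r)) := s in let '(x', r') := s' in 0 < r ->
    0 < r' /\ r' <= r / 2 /\ norm (minus x' x) <= r / 2 /\
    forall z : H, norm (minus z x') <= r' -> exists n, INR k < norm (T n z)))
    as [F hF].
  { intros [k [x r]]. destruct (Rlt_le_dec 0 r) as [h|h].
    - destruct (step k x r h) as [x' [r' h']]. exists (x', r'). auto.
    - exists (x, r). intros. lra. }
  set (s := fix s k := match k with O => ((zero : H), 1) | S k => F (k, s k) end).
  set (x := fun k => fst (s k)). set (r := fun k => snd (s k)).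
  assert (hs : forall k, 0 < r k -> 0 < r (S k) /\ r (S k) <= r k / 2 /\
    norm (minus (x (S k)) (x k)) <= r k / 2 /\
    forall z : H, norm (minus z (x (S k))) <= r (S k) -> exists n, INR k < norm (T n z)).
  { intros k. unfold r, x. simpl. specialize (hF (k, s k)).
    destruct (s k) as [xk rk]. destruct (F (k, (xk, rk))) as [x' r']. exact hF. }
  assert (rp : forall k, 0 < r k).
  { intros k. induction k as [|k IH]; [unfold r; simpl; lra|]. now apply hs. }
  assert (rs : forall k, r k <= (/ 2) ^ k).
  { intros k. induction k as [|k IH]; [unfold r; simpl; lra|].
    destruct (hs k (rp k)) as [_ [h _]].
    change ((/ 2) ^ S k) with (/ 2 * (/ 2) ^ k). lra. }
  assert (nest : forall k j (z : H), norm (minus z (x (k + j)%nat)) <= r (k + j)%nat ->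
            norm (minus z (x k)) <= r k).
  { intros k j. induction j as [|j IH]; intros z hz.
    - now rewrite Nat.add_0_r in hz.
    - apply IH. rewrite Nat.add_succ_r in hz.
      destruct (hs (k + j)%nat (rp _)) as [_ [h1 [h2 _]]].
      assert (I1 := norm_triangle_minus _ z (x (S (k + j))) (x (k + j)%nat)). lra. }
  assert (rsmall : forall e, 0 < e -> forall k, exists j, r (k + j)%nat <= e).
  { intros e he k. destruct (pow_lt_1_zero (/ 2)) with (y := e) as [N hN].
    - rewrite Rabs_right; lra.
    - assumption.
    - exists N. assert (h := hN (k + N)%nat ltac:(lia)).
      assert (I1 := rs (k + N)%nat). assert (I2 := Rle_abs ((/ 2) ^ (k + N))). lra. }
  destruct (cauchy_family H
    (fun e z => exists k, r k <= e /\ norm (minus z (x k)) <= r k)) as [l hl].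
  - intros e he. destruct (rsmall e he 0%nat) as [j hj].
    exists (x j), j. split; [exact hj|]. rewrite norm_minus_self. now left.
  - intros e e' z he [k [hk h]]. exists k. split; [lra | assumption].
  - intros e he. exists (e / 3). split; [lra|]. intros z1 z2 [k1 [h1 n1]] [k2 [h2 n2]].
    destruct (Nat.le_gt_cases k1 k2) as [le|le].
    + replace k2 with (k1 + (k2 - k1))%nat in n2 by lia. apply nest in n2.
      assert (I1 := norm_triangle_minus _ z1 (x k1) z2).
      rewrite (norm_minus_sym _ (x k1)) in I1. lra.
    + replace k1 with (k2 + (k1 - k2))%nat in n1 by lia. apply nest in n1.
      assert (I1 := norm_triangle_minus _ z1 (x k2) z2).
      rewrite (norm_minus_sym _ (x k2)) in I1. lra.
  - assert (inb : forall k, norm (minus l (x k)) <= r k).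
    { intros k. apply (le_of_small _ _ 1). intros e he _.
      destruct (hl e he) as [t [ht h]]. destruct (rsmall t ht k) as [j hj].
      assert (self : norm (minus (x (k + j)%nat) (x (k + j)%nat)) <= r (k + j)%nat)
        by (rewrite norm_minus_self; now left).
      specialize (h (x (k + j)%nat) (ex_intro _ (k + j)%nat (conj hj self))).
      apply nest in self.
      assert (I1 := norm_triangle_minus _ l (x (k + j)%nat) (x k)).
      rewrite (norm_minus_sym _ l (x (k + j)%nat)) in I1. lra. }
    destruct (PB l) as [M hM]. destruct (nfloor_ex (Rabs M)) as [k [_ hk]];
      [apply Rabs_pos|].
    destruct (hs (S k) (rp (S k))) as [_ [_ [_ h]]].
    destruct (h l (inb _)) as [n hn]. specialize (hM n).
    rewrite S_INR in hn. assert (I1 := Rle_abs M). lra.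
Qed.

(** Otherwise there are times [h n] tending to 0 with operator norms above [n + 1]. Strong
    continuity at 0 bounds each orbit along these times, which contradicts uniform boundedness. *)
Lemma semigroup_bounded_near_0 (H : hilbert) (A : operator H) (E : R -> H -> H) :
  is_semigroup_of A E ->
  exists h0 M, 0 < h0 /\ 0 < M /\
    forall h (x : H), 0 <= h <= h0 -> norm (E h x) <= M * norm x.
Proof.
  intros [EL [E0 [ES [EC _]]]]. apply NNPP. intros no.
  assert (ex : forall n : nat, exists h, 0 <= h <= / INR (n + 1) /\
    exists x : H, INR (n + 1) * norm x < norm (E h x)).
  { intros n. apply NNPP. intros no2. apply no.
    assert (pn : 0 < INR (n + 1)) by (apply lt_0_INR; lia).
    exists (/ INR (n + 1)), (INR (n + 1)).
    split; [now apply Rinv_0_lt_compat|]. split; [assumption|].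
    intros h x hh. apply Rnot_lt_le. intros lt. apply no2. exists h. split; [assumption|].
    now exists x. }
  destruct (functional_choice _ ex) as [h hh].
  destruct (uniform_boundedness H (fun n => E (h n))) as [M hM].
  - intros n. apply EL, hh.
  - intros x. specialize (EC x).
    rewrite filterlim_norm_lt in EC by apply within_filter, locally_filter.
    destruct (EC 1 Rlt_0_1) as [[d hd] near].
    destruct (nfloor_ex (/ d)) as [N [_ hN]]; [left; now apply Rinv_0_lt_compat|].
    assert (tail : forall n, (N <= n)%nat -> norm (E (h n) x) <= norm x + 1).
    { intros n hn. destruct (hh n) as [[h1 h2] _].
      destruct (Req_dec (h n) 0) as [Z|Z]; [rewrite Z, E0; lra|].
      assert (lt : / INR (n + 1) < d).
      { rewrite <- (Rinv_inv d). apply Rinv_lt_contravar.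
        - apply Rmult_lt_0_compat; [now apply Rinv_0_lt_compat|]. apply lt_0_INR. lia.
        - apply Rlt_le_trans with (1 := hN). rewrite <- S_INR. apply le_INR. lia. }
      assert (I1 : norm (minus (E (h n) x) x) < 1).
      { apply near; [|lra]. change (Rabs (h n - 0) < d). rewrite Rabs_right; lra. }
      assert (I2 := norm_le_minus _ (E (h n) x) x). lra. }
    (* The finitely many indices below [N] are absorbed one at a time by enlarging the bound. *)
    clear -tail. revert tail. generalize (norm x + 1). induction N as [|N IH]; intros M hM.
    + exists M. intros n. apply hM. lia.
    + apply (IH (Rmax M (norm (E (h N) x)))). intros n hn.
      destruct (Nat.eq_dec n N) as [->|ne]; [apply Rmax_r|].
      eapply Rle_trans; [apply hM; lia | apply Rmax_l].
  - destruct (nfloor_ex (Rabs M)) as [k [_ hk]]; [apply Rabs_pos|].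
    destruct (hh k) as [_ [x hx]]. specialize (hM k x).
    assert (N := norm_nonneg _ x). assert (I1 := Rle_abs M).
    rewrite plus_INR in hx. simpl in hx. nra.
Qed.

(** Right continuity is [E (t + h) x - E t x = E t (E h x - x)]. On the left the prefactor [E s]
    varies with [s]; it is split as [E (s - (t - h1))] after the fixed [E (t - h1)], and the local
    bound near 0 makes it uniform. *)
Lemma semigroup_continuous (H : hilbert) (A : operator H) (E : R -> H -> H)
    (x : H) (t : R) :
  is_semigroup_of A E -> 0 < t -> continuous (fun s => E s x) t.
Proof.
  intros SG ht. destruct (semigroup_bounded_near_0 H A E SG) as [h0 [M [ph0 [pM hM]]]].
  destruct SG as [EL [E0 [ES [EC _]]]].
  apply (filterlim_norm_lt H _ (locally t)); [apply locally_filter|]. intros e he.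
  specialize (EC x).
  rewrite filterlim_norm_lt in EC by apply within_filter, locally_filter.
  destruct (linear_bound H (E t) (EL t (Rlt_le _ _ ht))) as [Mt [pMt hMt]].
  assert (right : exists d, 0 < d /\
            forall h, 0 < h < d -> norm (minus (E (h + t) x) (E t x)) < e).
  { destruct (EC (e / Mt)) as [[d hd] near]; [now apply Rdiv_lt_0_compat|].
    exists d. split; [assumption|]. intros h hh.
    rewrite (Rplus_comm h), ES, <- (linear_minus_H H (E t)) by (lra || apply EL; lra).
    eapply Rle_lt_trans; [apply hMt|].
    assert (I1 : norm (minus (E h x) x) < e / Mt).
    { apply near; [|lra]. change (Rabs (h - 0) < d). rewrite Rabs_right; lra. }
    apply (Rmult_lt_compat_l Mt) in I1; [|assumption].
    replace (Mt * (e / Mt)) with e in I1 by (field; lra). exact I1. }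
  assert (left : exists d, 0 < d /\
            forall s, t - d < s < t -> norm (minus (E s x) (E t x)) < e).
  { set (h1 := Rmin h0 t).
    assert (ph1 : 0 < h1) by now apply Rmin_pos.
    assert (I1 : h1 <= h0) by apply Rmin_l. assert (I2 : h1 <= t) by apply Rmin_r.
    destruct (linear_bound H (E (t - h1))) as [Ms [pMs hMs]]; [apply EL; lra|].
    assert (pMM : 0 < M * Ms) by now apply Rmult_lt_0_compat.
    destruct (EC (e / (M * Ms))) as [[d hd] near]; [now apply Rdiv_lt_0_compat|].
    exists (Rmin d h1). split; [now apply Rmin_pos|]. intros s hs.
    assert (I3 := Rmin_l d h1). assert (I4 := Rmin_r d h1).
    rewrite norm_minus_sym. replace t with (s + (t - s)) at 1 by ring.
    rewrite ES, <- (linear_minus_H H (E s)) by (lra || apply EL; lra).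
    replace s with ((s - (t - h1)) + (t - h1)) at 1 by ring.
    rewrite ES by lra.
    assert (I5 : norm (minus (E (t - s) x) x) < e / (M * Ms)).
    { apply near; [|lra]. change (Rabs (t - s - 0) < d). rewrite Rabs_right; lra. }
    apply (Rmult_lt_compat_l (M * Ms)) in I5; [|assumption].
    replace (M * Ms * (e / (M * Ms))) with e in I5 by (field; lra).
    eapply Rle_lt_trans; [|exact I5].
    eapply Rle_trans; [apply hM; lra|]. rewrite Rmult_assoc.
    apply Rmult_le_compat_l; [lra | apply hMs]. }
  destruct right as [d1 [pd1 h1]]. destruct left as [d2 [pd2 h2]].
  exists (mkposreal _ (Rmin_pos _ _ pd1 pd2)). intros s hs.
  change (Rabs (s - t) < Rmin d1 d2) in hs.
  assert (I1 := Rmin_l d1 d2). assert (I2 := Rmin_r d1 d2).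
  apply Rabs_def2 in hs.
  destruct (Rtotal_order s t) as [lt|[->|gt]].
  - apply h2. lra.
  - rewrite norm_minus_self. assumption.
  - replace s with ((s - t) + t) by ring. apply h1. lra.
Qed.

(** * Estimates from right derivatives *)

Lemma continuous_left_le (phi : R -> R) (t e : R) :
  0 < t -> continuous phi t -> 0 < e ->
  exists d, 0 < d /\ forall s, t - d < s <= t -> phi t <= phi s + e.
Proof.
  intros ht C he. destruct (C (fun y => phi t - e < y)) as [[d hd] h].
  { exists (mkposreal e he). intros y hy. change (Rabs (y - phi t) < e) in hy.
    apply Rabs_def2 in hy. lra. }
  exists d. split; [assumption|]. intros s hs.
  assert (I1 : phi t - e < phi s); [|lra].
  apply h. change (Rabs (s - t) < d). apply Rabs_def1; lra.
Qed.

(** Connectedness argument with slack [eta]: the supremum [m] of the times up to which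
    [phi s <= phi 0 + eta s] is attained by continuity from the left, and the bound on the right
    derivative moves past it unless [m = T]. *)
Lemma nonincreasing_of_right_derivative (phi : R -> R) (T : R) :
  0 <= T ->
  (forall t, 0 < t <= T -> continuous phi t) ->
  (forall t, 0 <= t < T -> forall eta, 0 < eta ->
     exists d, 0 < d /\ forall h, 0 < h < d -> phi (t + h) <= phi t + eta * h) ->
  phi T <= phi 0.
Proof.
  intros hT C D. apply (le_of_small _ _ T). intros eta heta _.
  set (S := fun t => 0 <= t <= T /\ forall s, 0 <= s <= t -> phi s <= phi 0 + eta * s).
  assert (S0 : S 0).
  { split; [lra|]. intros s hs. replace s with 0 by lra. lra. }
  destruct (completeness S) as [m [ub lub]].
  { exists T. intros t [ht _]. lra. }
  { now exists 0. }
  assert (m0 : 0 <= m) by now apply ub.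
  assert (mT : m <= T) by (apply lub; intros t [ht _]; lra).
  assert (below : forall s, 0 <= s < m -> phi s <= phi 0 + eta * s).
  { intros s hs. apply NNPP. intros no. assert (m <= s); [|lra].
    apply lub. intros t [ht h]. apply Rnot_lt_le. intros lt. apply no, h. lra. }
  assert (Sm : S m).
  { split; [lra|]. intros s hs. destruct (Rlt_le_dec s m) as [|le]; [apply below; lra|].
    replace s with m by lra. destruct (Req_dec m 0) as [->|ne]; [lra|].
    apply (le_of_small _ _ 1). intros e he _.
    destruct (continuous_left_le phi m e) as [d [pd h]]; [lra | apply C; lra | assumption|].
    set (s' := Rmax 0 (m - d / 2)).
    assert (I1 : 0 <= s') by apply Rmax_l. assert (I2 : m - d / 2 <= s') by apply Rmax_r.
    assert (I3 : s' < m) by (apply Rmax_lub_lt; lra).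
    specialize (h s' ltac:(lra)). specialize (below s' ltac:(lra)).
    assert (eta * s' <= eta * m) by (apply Rmult_le_compat_l; lra). lra. }
  assert (mE : m = T).
  { apply NNPP. intros ne. destruct (D m ltac:(lra) eta heta) as [d [pd h]].
    set (k := Rmin (d / 2) (T - m)).
    assert (pk : 0 < k) by (apply Rmin_pos; lra).
    assert (I1 : k <= d / 2) by apply Rmin_l. assert (I2 : k <= T - m) by apply Rmin_r.
    assert (m + k <= m); [|lra]. apply ub. split; [lra|]. intros s hs.
    destruct (Rle_lt_dec s m) as [le|lt]; [apply Sm; lra|].
    specialize (h (s - m) ltac:(lra)). replace (m + (s - m)) with s in h by ring.
    assert (I3 := proj2 Sm m ltac:(lra)). lra. }
  rewrite <- mE at 1. rewrite <- mE. assert (I3 := proj2 Sm m ltac:(lra)). lra.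
Qed.

Lemma exp_monotone (x y : R) : x <= y -> exp x <= exp y.
Proof.
  intros [lt| ->]; [left; now apply exp_increasing | now right].
Qed.

(** [exp (k t) phi t] is nonincreasing because [exp (k s) (1 - k s) <= 1]; nonnegativity of [phi]
    allows multiplication of this bound. *)
Lemma exp_decay_of_right_derivative (phi : R -> R) (k T : R) :
  0 <= T -> (forall t, 0 <= phi t) ->
  (forall t, 0 < t <= T -> continuous phi t) ->
  (forall t, 0 <= t < T -> forall eta, 0 < eta ->
     exists d, 0 < d /\
       forall h, 0 < h < d -> phi (t + h) <= (1 - k * h) * phi t + eta * h) ->
  phi T <= exp (- k * T) * phi 0.
Proof.
  intros hT pos C D.
  assert (M : exp (k * T) * phi T <= exp (k * 0) * phi 0).
  { apply (nonincreasing_of_right_derivative (fun t => exp (k * t) * phi t)); [assumption| |].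
    - intros t ht. apply (continuous_mult (fun t => exp (k * t)) phi); [|now apply C].
      apply continuous_exp_comp.
      apply (continuous_mult (fun _ => k) (fun t => t));
        [apply continuous_const | apply continuous_id].
    - intros t ht eta heta.
      (* [exp (Rabs k)] bounds [exp (k s)] for steps [s < 1]; dividing [eta] by this product
         compensates for both exponential factors. *)
      assert (pc : 0 < exp (k * t) * exp (Rabs k)) by (apply Rmult_lt_0_compat; apply exp_pos).
      destruct (D t ht (eta / (exp (k * t) * exp (Rabs k)))) as [d [pd h]];
        [now apply Rdiv_lt_0_compat|].
      exists (Rmin d 1). split; [apply Rmin_pos; lra|]. intros s hs.
      assert (I1 := Rmin_l d 1). assert (I2 := Rmin_r d 1).
      specialize (h s ltac:(lra)).
      rewrite Rmult_plus_distr_l, exp_plus.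
      assert (P1 := exp_pos (k * t)). assert (P2 := exp_pos (k * s)).
      assert (P3 : exp (k * s) <= exp (Rabs k)).
      { apply exp_monotone. assert (I3 := Rle_abs k). assert (I4 := Rabs_pos k). nra. }
      assert (P4 : exp (k * s) * (1 - k * s) <= 1).
      { replace 1 with (exp (k * s) * exp (- (k * s))) at 2
          by (rewrite <- exp_plus, Rplus_opp_r; apply exp_0).
        apply Rmult_le_compat_l; [lra|]. assert (I3 := exp_ineq1_le (- (k * s))). lra. }
      assert (Q1 : exp (k * s) * phi (t + s) <= phi t
                    + exp (k * s) * (eta / (exp (k * t) * exp (Rabs k)) * s)).
      { apply (Rmult_le_compat_l (exp (k * s))) in h; [|lra].
        assert (I3 := Rmult_le_compat_r (phi t) _ _ (pos t) P4). lra. }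
      assert (Q2 : exp (k * s) * (eta / (exp (k * t) * exp (Rabs k)) * s)
             <= eta / exp (k * t) * s).
      { replace (eta / exp (k * t) * s)
          with (exp (Rabs k) * (eta / (exp (k * t) * exp (Rabs k)) * s))
          by (field; split; apply Rgt_not_eq, exp_pos).
        apply Rmult_le_compat_r; [|assumption].
        left. apply Rmult_lt_0_compat; [now apply Rdiv_lt_0_compat | lra]. }
      replace (exp (k * t) * exp (k * s) * phi (t + s))
        with (exp (k * t) * (exp (k * s) * phi (t + s))) by ring.
      replace (exp (k * t) * phi t + eta * s)
        with (exp (k * t) * (phi t + eta / exp (k * t) * s)) by (field; lra).
      apply Rmult_le_compat_l; lra. }
  rewrite Rmult_0_r, exp_0, Rmult_1_l in M.
  replace (phi T) with (exp (- k * T) * (exp (k * T) * phi T)).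
  - apply Rmult_le_compat_l; [left; apply exp_pos | assumption].
  - rewrite <- Rmult_assoc, <- exp_plus. replace (- k * T + k * T) with 0 by ring.
    rewrite exp_0. ring.
Qed.

(** The sign of [phi] is unknown, so the decay lemma is applied to its square, with rate [2 k] and
    initial value 0. *)
Lemma zero_of_right_derivative (phi : R -> R) (k T : R) :
  0 <= T -> phi 0 = 0 ->
  (forall t, 0 < t <= T -> continuous phi t) ->
  (forall t, 0 <= t < T -> forall eta, 0 < eta ->
     exists d, 0 < d /\
       forall h, 0 < h < d -> Rabs (phi (t + h) - (1 - k * h) * phi t) <= eta * h) ->
  phi T = 0.
Proof.
  intros hT Z C D.
  assert (M : phi T ^ 2 <= exp (- (2 * k) * T) * phi 0 ^ 2).
  { apply (exp_decay_of_right_derivative (fun t => phi t ^ 2)); [assumption| | |].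
    - intros t. apply pow2_ge_0.
    - intros t ht. apply continuous_ext with (fun t => phi t * phi t);
        [intros s; simpl; ring|].
      now apply (continuous_mult phi phi); apply C.
    - intros t ht eta heta.
      (* The three summands bound the second-order term of [(1 - k s) ^ 2], the cross term with the
         remainder [r], and [r ^ 2], each in units of [e s]. *)
      set (c := k ^ 2 * phi t ^ 2 + 2 * (1 + Rabs k) * Rabs (phi t) + 1).
      assert (N1 := Rabs_pos k). assert (N2 := Rabs_pos (phi t)).
      assert (pc : 0 < c).
      { unfold c. assert (0 <= k ^ 2 * phi t ^ 2)
          by (apply Rmult_le_pos; apply pow2_ge_0).
        assert (0 <= (1 + Rabs k) * Rabs (phi t)) by (apply Rmult_le_pos; lra). lra. }
      set (e := Rmin 1 (eta / c)).
      assert (pe : 0 < e) by (apply Rmin_pos; [lra | now apply Rdiv_lt_0_compat]).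
      assert (e1 : e <= 1) by apply Rmin_l.
      assert (ec : e * c <= eta).
      { assert (I1 : e <= eta / c) by apply Rmin_r.
        apply (Rmult_le_compat_r c) in I1; [|lra].
        replace (eta / c * c) with eta in I1 by (field; lra). assumption. }
      destruct (D t ht e pe) as [d [pd h]].
      exists (Rmin d e). split; [now apply Rmin_pos|]. intros s hs.
      assert (I1 := Rmin_l d e). assert (I2 := Rmin_r d e).
      specialize (h s ltac:(lra)).
      set (r := phi (t + s) - (1 - k * s) * phi t) in *.
      replace (phi (t + s)) with ((1 - k * s) * phi t + r) by (unfold r; ring).
      assert (R2 : r ^ 2 <= e * s * s).
      { rewrite <- (pow2_abs r). assert (N3 := Rabs_pos r).
        apply Rle_trans with (e * s * (e * s)); [nra|].
        apply Rmult_le_compat_l; nra. }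
      assert (R1 : (1 - k * s) * phi t * r <= (1 + Rabs k) * Rabs (phi t) * (e * s)).
      { eapply Rle_trans; [apply Rle_abs|]. rewrite !Rabs_mult.
        apply Rmult_le_compat; [|apply Rabs_pos| |assumption].
        - apply Rmult_le_pos; apply Rabs_pos.
        - apply Rmult_le_compat_r; [assumption|].
          unfold Rminus. eapply Rle_trans; [apply Rabs_triang|].
          rewrite Rabs_R1, Rabs_Ropp, Rabs_mult, (Rabs_right s) by lra. nra. }
      assert (R3 : (k * s) ^ 2 * phi t ^ 2 <= k ^ 2 * phi t ^ 2 * (e * s)).
      { replace ((k * s) ^ 2 * phi t ^ 2) with (k ^ 2 * phi t ^ 2 * (s * s)) by ring.
        apply Rmult_le_compat_l; [apply Rmult_le_pos; apply pow2_ge_0 | nra]. }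
      assert (R4 : e * s * s <= e * s) by nra.
      assert (R5 : e * c * s <= eta * s) by (apply Rmult_le_compat_r; lra).
      unfold c in R5. nra. }
  rewrite Z in M. replace (exp (- (2 * k) * T) * 0 ^ 2) with 0 in M by ring.
  assert (I1 := pow2_ge_0 (phi T)). nra.
Qed.

(** * Decay of semigroups *)

Lemma at_right_0_small (P : R -> Prop) :
  at_right 0 P -> exists d, 0 < d /\ forall h, 0 < h < d -> P h.
Proof.
  intros [[d hd] h]. exists d. split; [assumption|]. intros s hs.
  apply h; [|lra]. change (Rabs (s - 0) < d). rewrite Rabs_right; lra.
Qed.

(** The bounded operator [E t] commutes with the difference quotients at 0 and with their limit. *)
Lemma semigroup_dom (H : hilbert) (A : operator H) (E : R -> H -> H)
    (x : H) (t : R) :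
  is_semigroup_of A E -> 0 <= t -> dom A x ->
  dom A (E t x) /\ A (E t x) = E t (A x).
Proof.
  intros [EL [E0 [ES [EC EG]]]] ht dx.
  assert (D : filterlim (fun h => scal (/ h) (minus (E h x) x)) (at_right 0)
                (locally (opp (A x)))) by (apply EG; split; [assumption | reflexivity]).
  destruct (linear_bound H (E t) (EL t ht)) as [M [pM hM]].
  assert (lin : forall (a : R) (u v w : H), E t (minus (scal a (minus u v)) w) =
            minus (scal a (minus (E t u) (E t v))) (E t w)).
  { intros a u v w.
    now rewrite (linear_minus_H H (E t)), (linear_scal_H H (E t)), (linear_minus_H H (E t))
      by now apply EL. }
  destruct (proj1 (EG (E t x) (E t (opp (A x))))) as [h1 h2].
  - apply (filterlim_norm_lt H _ (at_right 0)); [apply within_filter, locally_filter|].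
    intros e he.
    destruct (at_right_0_small _ (proj1 (filterlim_norm_lt H R (at_right 0) _ _ _) D
      (e / M) (Rdiv_lt_0_compat _ _ he pM))) as [d [pd h]].
    exists (mkposreal d pd). intros s bs ps.
    change (Rabs (s - 0) < d) in bs. apply Rabs_def2 in bs.
    specialize (h s ltac:(lra)).
    apply Rle_lt_trans with (norm (E t (minus (scal (/ s) (minus (E s x) x)) (opp (A x))))).
    + right. f_equal. symmetry. refine (eq_trans (lin _ _ _ _) _).
      rewrite <- !ES by lra. now rewrite (Rplus_comm s t).
    + eapply Rle_lt_trans; [apply hM|].
      apply (Rmult_lt_compat_l M) in h; [|assumption].
      replace (M * (e / M)) with e in h by (field; lra). exact h.
  - split; [assumption|].
    assert (E1 : E t (opp (A x)) = scal (-1) (E t (A x))).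
    { rewrite <- (linear_scal_H H (E t)) by now apply EL. f_equal. vec. }
    rewrite E1 in h2. transitivity (opp (scal (-1) (E t (A x)))); [|vec].
    rewrite h2. vec.
Qed.

Lemma semigroup_expansion (H : hilbert) (A : operator H) (E : R -> H -> H)
    (x : H) (t : R) :
  is_semigroup_of A E -> 0 <= t -> dom A x ->
  forall eta, 0 < eta -> exists d, 0 < d /\ forall h, 0 < h < d ->
    norm (minus (E (t + h) x) (minus (E t x) (scal h (A (E t x))))) <= eta * h.
Proof.
  intros SG ht dx eta heta.
  destruct (semigroup_dom H A E x t SG ht dx) as [dy _].
  destruct SG as [EL [E0 [ES [EC EG]]]].
  assert (D := proj2 (EG (E t x) (opp (A (E t x)))) (conj dy eq_refl)).
  destruct (at_right_0_small _ (proj1 (filterlim_norm_lt H R (at_right 0) _ _ _) D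
    eta heta)) as [d [pd h]].
  exists d. split; [assumption|]. intros s hs. specialize (h s hs).
  apply Rle_trans with
    (norm (scal s (minus (scal (/ s) (minus (E s (E t x)) (E t x))) (opp (A (E t x)))))).
  - right. f_equal. rewrite <- ES, (Rplus_comm s t) by lra.
    apply inner_ext. intros w. inner_simpl. field. lra.
  - rewrite norm_scal_eq, Rabs_right by lra. rewrite Rmult_comm.
    apply Rmult_le_compat_r; [lra | exact (Rlt_le _ _ h)].
Qed.

Lemma continuous_inner (H : hilbert) (u : R -> H) (w : H) (t : R) :
  continuous u t -> continuous (fun s => inner (u s) w) t.
Proof.
  intros C. unfold continuous in C.
  rewrite (filterlim_norm_lt H R (locally t)) in C by apply locally_filter.
  apply filterlim_locally. intros eps.
  assert (N := norm_nonneg _ w).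
  assert (pe : 0 < eps / (norm w + 1))
    by (apply Rdiv_lt_0_compat; [apply eps | lra]).
  apply (filter_imp (fun s => norm (minus (u s) (u t)) < eps / (norm w + 1)));
    [|now apply C].
  intros s hs. change (Rabs (inner (u s) w - inner (u t) w) < eps).
  rewrite <- inner_minus. eapply Rle_lt_trans; [apply cauchy_schwarz|].
  assert (N2 := norm_nonneg _ (minus (u s) (u t))).
  apply (Rmult_lt_compat_r (norm w + 1)) in hs; [|lra].
  replace (eps / (norm w + 1) * (norm w + 1)) with (pos eps) in hs by (field; lra).
  nra.
Qed.

Lemma continuous_norm_H (H : hilbert) (u : R -> H) (t : R) :
  continuous u t -> continuous (fun s => norm (u s)) t.
Proof.
  intros C. unfold continuous in C.
  rewrite (filterlim_norm_lt H R (locally t)) in C by apply locally_filter.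
  apply filterlim_locally. intros eps.
  apply (filter_imp (fun s => norm (minus (u s) (u t)) < eps)); [|apply C, eps].
  intros s hs. change (Rabs (norm (u s) - norm (u t)) < eps).
  assert (I1 := norm_le_minus _ (u s) (u t)).
  assert (I2 := norm_le_minus _ (u t) (u s)). rewrite norm_minus_sym in I2.
  apply Rabs_def1; lra.
Qed.

(** If [u' = - a] from the right, pairing with [w] leaves the scalar equation [y' = - l y] with zero
    initial value. Its three uses are the invariance of an eigenline, of its complement, and the
    agreement of two semigroups on a common eigenvector. *)
Lemma inner_zero_of_right_derivative (H : hilbert) (u a : R -> H) (w : H) (l T : R) :
  0 <= T ->
  (forall t, 0 < t <= T -> continuous u t) ->
  (forall t, 0 <= t < T -> forall eta, 0 < eta -> exists d, 0 < d /\
     forall h, 0 < h < d ->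
       norm (minus (u (t + h)) (minus (u t) (scal h (a t)))) <= eta * h) ->
  (forall t, 0 <= t < T -> inner (a t) w = l * inner (u t) w) ->
  inner (u 0) w = 0 -> inner (u T) w = 0.
Proof.
  intros hT C D eig Z.
  apply (zero_of_right_derivative (fun t => inner (u t) w) l T);
    [assumption | assumption | intros t ht; now apply continuous_inner, C |].
  intros t ht eta heta. assert (N := norm_nonneg _ w).
  destruct (D t ht (eta / (norm w + 1))) as [d [pd h]];
    [apply Rdiv_lt_0_compat; lra|].
  exists d. split; [assumption|]. intros s hs. specialize (h s hs).
  replace (inner (u (t + s)) w - (1 - l * s) * inner (u t) w)
    with (inner (minus (u (t + s)) (minus (u t) (scal s (a t)))) w)
    by (inner_simpl; rewrite (eig t ht); ring).
  eapply Rle_trans; [apply cauchy_schwarz|].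
  apply (Rmult_le_compat_r (norm w + 1)) in h; [|lra].
  replace (eta / (norm w + 1) * s * (norm w + 1)) with (eta * s) in h by (field; lra).
  assert (N2 := norm_nonneg _ (minus (u (t + s)) (minus (u t) (scal s (a t))))). nra.
Qed.

(** Energy estimate: the square of the norm has right derivative [- 2 <A y, y>], at most
    [- 2 c norm y ^ 2] as long as the orbit stays in [W]. *)
Lemma semigroup_decay_dom (H : hilbert) (A : operator H) (E : R -> H -> H)
    (W : H -> Prop) (c T : R) (x : H) :
  is_semigroup_of A E -> 0 <= T ->
  (forall t x, 0 <= t -> W x -> W (E t x)) ->
  (forall y, W y -> dom A y -> c * norm y ^ 2 <= inner (A y) y) ->
  W x -> dom A x -> norm (E T x) <= exp (- c * T) * norm x.
Proof.
  intros SG hT EW coer hx dx.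
  assert (M : norm (E T x) ^ 2 <= exp (- (2 * c) * T) * norm (E 0 x) ^ 2).
  { apply (exp_decay_of_right_derivative (fun t => norm (E t x) ^ 2)); [assumption| | |].
    - intros t. apply pow2_ge_0.
    - intros t ht. apply continuous_ext with (fun t => norm (E t x) * norm (E t x));
        [intros s; simpl; ring|].
      apply (continuous_mult (fun t => norm (E t x)) (fun t => norm (E t x)));
        apply continuous_norm_H, (semigroup_continuous H A); (assumption || lra).
    - intros t ht eta heta. set (y := E t x). set (z := A y).
      assert (cy : c * norm y ^ 2 <= inner z y).
      { apply coer; [apply EW; [lra | assumption]|].
        apply (semigroup_dom H A E x t SG); [lra | assumption]. }
      assert (Ny := norm_nonneg _ y). assert (Nz := norm_nonneg _ z).
      (* [k] collects, in units of [e s], the quadratic term [s ^ 2 norm z ^ 2], the cross term with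
         the remainder, and the squared remainder. *)
      set (k := norm z ^ 2 + 2 * (norm y + norm z) + 1).
      assert (pk : 0 < k) by (unfold k; nra).
      set (e := Rmin 1 (eta / k)).
      assert (pe : 0 < e) by (apply Rmin_pos; [lra | now apply Rdiv_lt_0_compat]).
      assert (e1 : e <= 1) by apply Rmin_l.
      assert (ek : e * k <= eta).
      { assert (I1 : e <= eta / k) by apply Rmin_r.
        apply (Rmult_le_compat_r k) in I1; [|lra].
        replace (eta / k * k) with eta in I1 by (field; lra). assumption. }
      destruct (semigroup_expansion H A E x t SG (proj1 ht) dx e pe) as [d [pd h]].
      exists (Rmin d e). split; [now apply Rmin_pos|]. intros s hs.
      assert (I1 := Rmin_l d e). assert (I2 := Rmin_r d e).
      specialize (h s ltac:(lra)). fold y in h. fold z in h.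
      set (r := minus (E (t + s) x) (minus y (scal s z))) in *.
      set (p := minus y (scal s z)) in *.
      assert (Er : E (t + s) x = plus p r) by (unfold r; vec).
      rewrite Er, norm_plus_sq.
      assert (P1 : norm p ^ 2 = norm y ^ 2 - 2 * s * inner z y + s ^ 2 * norm z ^ 2).
      { unfold p. rewrite <- !inner_norm. inner_simpl. rewrite (inner_sym y z). ring. }
      assert (P2 : norm p <= norm y + norm z).
      { unfold p. eapply Rle_trans; [apply norm_minus_le|].
        rewrite norm_scal_eq, Rabs_right by lra. nra. }
      assert (P3 : inner p r <= (norm y + norm z) * (e * s)).
      { eapply Rle_trans; [apply Rle_abs|]. eapply Rle_trans; [apply cauchy_schwarz|].
        apply Rmult_le_compat; (apply norm_nonneg || assumption). }
      assert (Nr := norm_nonneg _ r).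
      assert (P4 : norm r ^ 2 <= e * s).
      { apply Rle_trans with (e * s * (e * s)); [nra|].
        rewrite <- (Rmult_1_r (e * s)) at 3. apply Rmult_le_compat_l; nra. }
      assert (P5 : s ^ 2 * norm z ^ 2 <= e * s * norm z ^ 2).
      { apply Rmult_le_compat_r; [apply pow2_ge_0 | nra]. }
      assert (P6 : e * k * s <= eta * s) by (apply Rmult_le_compat_r; lra).
      assert (P7 : s * (c * norm y ^ 2) <= s * inner z y)
        by (apply Rmult_le_compat_l; lra).
      unfold k in P6. lra. }
  destruct SG as [_ [E0 _]]. rewrite E0 in M.
  apply sq_le_le.
  - apply Rmult_le_pos; [left; apply exp_pos | apply norm_nonneg].
  - rewrite Rpow_mult_distr. replace (exp (- c * T) ^ 2) with (exp (- (2 * c) * T));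
      [assumption|].
    replace (- (2 * c) * T) with (- c * T + - c * T) by ring. rewrite exp_plus. ring.
Qed.

Lemma semigroup_decay (H : hilbert) (A : operator H) (E : R -> H -> H)
    (W : H -> Prop) (c T : R) (x : H) :
  is_semigroup_of A E -> 0 <= T ->
  (forall t x, 0 <= t -> W x -> W (E t x)) ->
  (forall y, W y -> dom A y -> c * norm y ^ 2 <= inner (A y) y) ->
  (forall x r, W x -> 0 < r -> exists y, W y /\ dom A y /\ norm (minus x y) < r) ->
  W x -> norm (E T x) <= exp (- c * T) * norm x.
Proof.
  intros SG hT EW coer dens hx.
  destruct (linear_bound H (E T)) as [M [pM hM]]; [now apply SG|].
  assert (pe := exp_pos (- c * T)).
  apply (le_of_small _ _ (M + exp (- c * T))). intros e he _.
  destruct (dens x e hx he) as [y [hy [dy n]]].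
  assert (I1 := semigroup_decay_dom H A E W c T y SG hT EW coer hy dy).
  assert (I2 := norm_le_minus _ (E T x) (E T y)).
  rewrite <- (linear_minus_H H (E T)) in I2 by now apply SG.
  assert (I3 := hM (minus x y)).
  assert (I4 := norm_le_minus _ y x). rewrite norm_minus_sym in I4.
  assert (M * norm (minus x y) <= M * e) by (apply Rmult_le_compat_l; lra).
  assert (exp (- c * T) * norm y <= exp (- c * T) * (norm x + e))
    by (apply Rmult_le_compat_l; lra).
  lra.
Qed.

(** * Semigroups and eigenspaces *)

(** Expresses weakly that [E t e] stays on the line of [e], without solving for the exponential
    factor. *)
Lemma semigroup_eigenvector_perp (H : hilbert) (A : operator H) (E : R -> H -> H)
    (e w : H) (l t : R) :
  is_semigroup_of A E -> dom A e -> A e = scal l e -> inner e w = 0 -> 0 <= t ->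
  inner (E t e) w = 0.
Proof.
  intros SG de ee Z ht.
  apply (inner_zero_of_right_derivative H (fun t => E t e) (fun t => A (E t e)) w l t ht).
  - intros s hs. apply (semigroup_continuous H A); [assumption | lra].
  - intros s hs. apply semigroup_expansion; (assumption || lra).
  - intros s hs. destruct (semigroup_dom H A E e s SG) as [_ h]; [lra | assumption|].
    rewrite h, ee, (linear_scal_H H (E s)) by (apply SG; lra). apply inner_scal.
  - destruct SG as [_ [E0 _]]. now rewrite E0.
Qed.

(** The hypothesis is the weak eigenvalue equation instead of self-adjointness, so that the lemma
    also covers the renormalized operator. *)
Lemma semigroup_perp_eigenvector (H : hilbert) (A : operator H) (E : R -> H -> H)
    (e x : H) (l t : R) :
  is_semigroup_of A E -> (forall z, dom A z -> inner (A z) e = l * inner z e) ->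
  dom A x -> inner x e = 0 -> 0 <= t -> inner (E t x) e = 0.
Proof.
  intros SG sym dx Z ht.
  apply (inner_zero_of_right_derivative H (fun t => E t x) (fun t => A (E t x)) e l t ht).
  - intros s hs. apply (semigroup_continuous H A); [assumption | lra].
  - intros s hs. apply semigroup_expansion; (assumption || lra).
  - intros s hs. apply sym. apply (semigroup_dom H A E x s SG); [lra | assumption].
  - destruct SG as [_ [E0 _]]. now rewrite E0.
Qed.

Lemma semigroup_eigenvector_unique (H : hilbert) (A A' : operator H)
    (E E' : R -> H -> H) (e : H) (l t : R) :
  is_semigroup_of A E -> is_semigroup_of A' E' ->
  dom A e -> A e = scal l e -> dom A' e -> A' e = scal l e -> 0 <= t ->
  E t e = E' t e.
Proof.
  intros SG SG' de ee de' ee' ht. apply inner_ext. intros w.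
  assert (K : inner (minus (E t e) (E' t e)) w = 0).
  2:{ rewrite inner_minus in K. lra. }
  apply (inner_zero_of_right_derivative H (fun t => minus (E t e) (E' t e))
    (fun t => minus (A (E t e)) (A' (E' t e))) w l t ht).
  - intros s hs. unfold minus.
    apply (continuous_plus (fun s => E s e) (fun s => opp (E' s e))).
    + apply (semigroup_continuous H A); [assumption | lra].
    + apply (continuous_opp (fun s => E' s e)).
      apply (semigroup_continuous H A'); [assumption | lra].
  - intros s hs eta heta.
    destruct (semigroup_expansion H A E e s SG (proj1 hs) de (eta / 2)) as [d [pd h]]; [lra|].
    destruct (semigroup_expansion H A' E' e s SG' (proj1 hs) de' (eta / 2))
      as [d' [pd' h']]; [lra|].
    exists (Rmin d d'). split; [now apply Rmin_pos|]. intros k hk.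
    assert (I1 := Rmin_l d d'). assert (I2 := Rmin_r d d').
    specialize (h k ltac:(lra)). specialize (h' k ltac:(lra)).
    apply Rle_trans with (norm (minus
      (minus (E (s + k) e) (minus (E s e) (scal k (A (E s e)))))
      (minus (E' (s + k) e) (minus (E' s e) (scal k (A' (E' s e))))))).
    + right. f_equal. vec.
    + eapply Rle_trans; [apply norm_minus_le|]. lra.
  - intros s hs. destruct (semigroup_dom H A E e s SG) as [_ h]; [lra | assumption|].
    destruct (semigroup_dom H A' E' e s SG') as [_ h']; [lra | assumption|].
    rewrite h, h', ee, ee'.
    rewrite (linear_scal_H H (E s)) by (apply SG; lra).
    rewrite (linear_scal_H H (E' s)) by (apply SG'; lra).
    inner_simpl. ring.
  - destruct SG as [_ [E0 _]]. destruct SG' as [_ [E0' _]]. rewrite E0, E0'.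
    inner_simpl. ring.
Qed.

Lemma linear_zero_H (H : hilbert) (T : H -> H) : is_linear T -> T zero = (zero : H).
Proof. exact (linear_zero T). Qed.

Lemma linear_axpy_H (H : hilbert) (T : H -> H) (a : R) (x y : H) :
  is_linear T -> T (plus (scal a x) y) = plus (scal a (T x)) (T y).
Proof.
  intros L. refine (eq_trans (linear_plus T L _ _) _).
  now rewrite (linear_scal_H H T).
Qed.

(** With the equalizer below, this supplies the closed subspaces for [closed_span_incl]. Closedness
    uses the operator bound contained in [is_linear]. *)
Lemma closed_subspace_preimage (H : hilbert) (V : H -> Prop) (T : H -> H) :
  closed_subspace H V -> is_linear T -> closed_subspace H (fun x => V (T x)).
Proof.
  intros [Z [L C]] LT. split; [|split].
  - now rewrite (linear_zero_H H T).
  - intros a x y hx hy. rewrite (linear_axpy_H H T) by assumption. now apply L.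
  - intros x hx. apply C. intros r hr.
    destruct (linear_bound H T LT) as [M [pM hM]].
    destruct (hx (r / M)) as [y [hy n]]; [now apply Rdiv_lt_0_compat|].
    exists (T y). split; [assumption|].
    rewrite <- (linear_minus_H H T) by assumption.
    eapply Rle_lt_trans; [apply hM|].
    apply (Rmult_lt_compat_l M) in n; [|assumption].
    replace (M * (r / M)) with r in n by (field; lra). exact n.
Qed.

Lemma closed_subspace_equalizer (H : hilbert) (T T' : H -> H) :
  is_linear T -> is_linear T' -> closed_subspace H (fun x => T x = T' x).
Proof.
  intros L L'. split; [|split].
  - rewrite (linear_zero_H H T L). now rewrite (linear_zero_H H T' L').
  - intros a x y hx hy.
    rewrite (linear_axpy_H H T), (linear_axpy_H H T'), hx, hy by assumption. reflexivity.
  - intros x hx. apply eq_of_norm_minus.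
    destruct (linear_bound H T L) as [M [pM hM]].
    destruct (linear_bound H T' L') as [M' [pM' hM']].
    apply (small_zero _ (M + M')). intros e he _.
    destruct (hx e he) as [y [hy n]].
    assert (I1 := norm_triangle_minus _ (T x) (T y) (T' x)).
    rewrite hy in I1 at 2. rewrite (norm_minus_sym _ (T' y)) in I1.
    rewrite <- (linear_minus_H H T), <- (linear_minus_H H T') in I1 by assumption.
    assert (I2 := hM (minus x y)). assert (I3 := hM' (minus x y)).
    assert (M * norm (minus x y) <= M * e) by (apply Rmult_le_compat_l; lra).
    assert (M' * norm (minus x y) <= M' * e) by (apply Rmult_le_compat_l; lra).
    rewrite Rabs_right by (apply Rle_ge, norm_nonneg). lra.
Qed.

Lemma semigroup_eigenspace (H : hilbert) (A : operator H) (E : R -> H -> H)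
    (S : H -> Prop) (t : R) :
  is_semigroup_of A E -> 0 <= t ->
  (forall e, S e -> exists l, dom A e /\ A e = scal l e) ->
  forall x, closed_span S x -> closed_span S (E t x).
Proof.
  intros SG ht eig.
  assert (CV := closed_subspace_closed_span H S).
  apply closed_span_incl.
  - apply closed_subspace_preimage; [assumption | now apply SG].
  - intros e he. apply perp_perp; [assumption|]. intros w hw.
    destruct (eig e he) as [l [de ee]].
    apply (semigroup_eigenvector_perp H A E e w l t); try assumption.
    rewrite inner_sym. now apply hw, closed_span_mem.
Qed.

(** Orbits are differentiated only in the domain, hence the density of the domain within the
    complement, not just in the whole space. *)
Lemma semigroup_eigenspace_perp (H : hilbert) (A : operator H) (E : R -> H -> H)
    (S : H -> Prop) (t : R) :
  is_semigroup_of A E -> 0 <= t ->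
  (forall e, S e -> exists l, forall z, dom A z -> inner (A z) e = l * inner z e) ->
  (forall x r, perp H (closed_span S) x -> 0 < r ->
     exists y, perp H (closed_span S) y /\ dom A y /\ norm (minus x y) < r) ->
  forall x, perp H (closed_span S) x -> perp H (closed_span S) (E t x).
Proof.
  intros SG ht eig dens x hx.
  assert (LE : is_linear (E t)) by now apply SG.
  assert (CW := closed_subspace_preimage H _ (E t)
    (closed_subspace_perp H (closed_span S)) LE).
  apply (proj2 (proj2 CW)). intros r hr.
  destruct (dens x r hx hr) as [y [hy [dy n]]]. exists y. split; [|assumption].
  apply perp_closed_span. intros e he. destruct (eig e he) as [l hl].
  apply (semigroup_perp_eigenvector H A E e y l t); try assumption.
  now apply hy, closed_span_mem.
Qed.

Lemma proj_commutes (H : hilbert) (V : H -> Prop) (T : H -> H) (x : H) :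
  closed_subspace H V -> is_linear T ->
  (forall y, V y -> V (T y)) -> (forall y, perp H V y -> perp H V (T y)) ->
  orth_proj V (T x) = T (orth_proj V x).
Proof.
  intros CV LT h1 h2. destruct (orth_proj_spec H V x CV) as [hp pp].
  apply orth_proj_unique; [assumption | now apply h1 |].
  rewrite <- (linear_minus_H H T) by assumption. now apply h2.
Qed.

Lemma norm_is_RInt_exp_le (H : hilbert) (u : R -> H) (c M t : R) (I : H) :
  0 <= t -> 0 < c ->
  (forall s, 0 <= s <= t -> norm (u s) <= exp (- c * (t - s)) * M) -> 0 <= M ->
  is_RInt u 0 t I -> norm I <= M / c.
Proof.
  intros ht hc bd hM hI.
  assert (G : is_RInt (fun s => exp (- c * (t - s)) * M) 0 t
     (exp (- c * (t - t)) * M / c - exp (- c * (t - 0)) * M / c)).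
  { apply (is_RInt_derive (fun s => exp (- c * (t - s)) * M / c)).
    - intros s _. auto_derive; [trivial|]. unfold Rminus. field. lra.
    - intros s _. apply (ex_derive_continuous (fun s => exp (- c * (t - s)) * M)).
      auto_derive. trivial. }
  assert (L := norm_RInt_le u _ 0 t I _ ht bd hI G).
  eapply Rle_trans; [exact L|].
  replace (- c * (t - t)) with 0 by ring. rewrite exp_0.
  assert (P := exp_pos (- c * (t - 0))).
  assert (0 <= exp (- c * (t - 0)) * M / c).
  { apply Rmult_le_pos; [apply Rmult_le_pos; lra | left; now apply Rinv_0_lt_compat]. }
  lra.
Qed.

Lemma Riemann_sum_linear (H : hilbert) (P : H -> H) (u : R -> H) (ptd : SF_seq) :
  is_linear P -> P (Riemann_sum u ptd) = Riemann_sum (fun s => P (u s)) ptd.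
Proof.
  intros LP. induction ptd as [x0|h ptd IH] using SF_cons_ind.
  - exact (linear_zero_H H P LP).
  - rewrite !Riemann_sum_cons.
    refine (eq_trans (linear_axpy_H H P _ (u (snd h)) (Riemann_sum u ptd) LP) _).
    f_equal. exact IH.
Qed.

Lemma is_RInt_linear (H : hilbert) (P : H -> H) (u : R -> H) (a b : R) (I : H) :
  is_linear P -> is_RInt u a b I -> is_RInt (fun s => P (u s)) a b (P I).
Proof.
  intros LP hI.
  apply (filterlim_ext (fun ptd => P (scal (sign (b - a)) (Riemann_sum u ptd)))).
  - intros ptd. refine (eq_trans (linear_scal_H H P _ _ LP) _). f_equal.
    exact (Riemann_sum_linear H P u ptd LP).
  - eapply filterlim_comp; [exact hI|]. exact (linear_cont P I LP).
Qed.

(** The integral plus [eta] is a differentiable majorant [F] with [F' <= L F] on [0, T]. [eta]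
    stands inside the integral because the Lipschitz bound sees the whole difference of the
    solutions, of which [D] is the low-mode part. *)
Lemma gronwall (D : R -> R) (L eta T : R) :
  0 <= L -> 0 <= T -> 0 <= eta -> (forall s, continuous D s) ->
  (forall t, 0 <= t <= T -> D t <= RInt (fun s => L * (eta + D s)) 0 t) ->
  D T + eta <= exp (L * T) * eta.
Proof.
  intros hL hT heta C bd.
  set (g := fun s => L * (eta + D s)).
  assert (Cg : forall s, continuous g s).
  { intros s.
    apply (continuous_mult (fun _ => L) (fun s => eta + D s)); [apply continuous_const|].
    apply (continuous_plus (fun _ => eta) D); [apply continuous_const | apply C]. }
  set (F := fun t => RInt g 0 t + eta).
  assert (dF : forall t, is_derive F t (g t)).
  { intros t. unfold F. replace (g t) with (plus (g t) 0) by (unfold plus; simpl; ring).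
    apply (is_derive_plus (fun t => RInt g 0 t) (fun _ => eta)).
    - apply (is_derive_RInt g (fun t => RInt g 0 t) 0); [|apply Cg].
      apply filter_forall. intros s. apply (RInt_correct g).
      apply ex_RInt_continuous. intros z _. apply Cg.
    - apply (is_derive_const eta). }
  assert (F0 : F 0 = eta) by (unfold F; rewrite RInt_point; unfold zero; simpl; ring).
  assert (M : exp (- L * T) * F T <= exp (- L * 0) * F 0).
  { destruct (Req_dec T 0) as [->|ne]; [lra|].
    destruct (MVT_gen (fun t => exp (- L * t) * F t) 0 T
      (fun t => - L * exp (- L * t) * F t + exp (- L * t) * g t)) as [c [hc E]].
    - intros t _.
      assert (dE : is_derive (fun t => exp (- L * t)) t (- L * exp (- L * t)))
        by (auto_derive; [trivial | ring]).
      apply (is_derive_mult (fun t => exp (- L * t)) F t _ _ dE (dF t)).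
      intros n m; apply Rmult_comm.
    - intros t _. apply derivable_continuous_pt.
      exists (- L * exp (- L * t) * F t + exp (- L * t) * g t).
      apply is_derive_Reals.
      assert (dE : is_derive (fun t => exp (- L * t)) t (- L * exp (- L * t)))
        by (auto_derive; [trivial | ring]).
      apply (is_derive_mult (fun t => exp (- L * t)) F t _ _ dE (dF t)).
      intros n m; apply Rmult_comm.
    - rewrite Rmin_left, Rmax_right in hc by assumption.
      specialize (bd c hc). fold g in bd.
      assert (Gc : g c <= L * F c).
      { unfold F, g. apply Rmult_le_compat_l; [assumption|]. fold g. lra. }
      assert (P := exp_pos (- L * c)).
      assert (exp (- L * c) * g c <= exp (- L * c) * (L * F c))
        by (apply Rmult_le_compat_l; lra).
      assert (0 <= T * (exp (- L * c) * (L * F c) - exp (- L * c) * g c))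
        by (apply Rmult_le_pos; lra).
      lra. }
  rewrite F0, Rmult_0_r, exp_0, Rmult_1_l in M.
  assert (I1 : D T + eta <= F T).
  { assert (h := bd T ltac:(lra)). fold g in h. unfold F. lra. }
  apply (Rmult_le_compat_l (exp (L * T))) in M; [|left; apply exp_pos].
  rewrite <- Rmult_assoc, <- exp_plus in M.
  replace (L * T + - L * T) with 0 in M by ring. rewrite exp_0 in M. lra.
Qed.

(** * Comparison of the two flows *)

(** [real] sends both infinities to 0; the upper bound and the member together make the supremum
    finite. *)
Lemma le_real_Lub (S : R -> Prop) (M r : R) :
  (forall s, S s -> s <= M) -> S r -> r <= real (Lub_Rbar S).
Proof.
  intros ub hr. destruct (Lub_Rbar_correct S) as [h1 h2].
  assert (I1 := h1 r hr). assert (I2 : Rbar_le (Lub_Rbar S) M) by (apply h2; exact ub).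
  destruct (Lub_Rbar S) as [l| |]; simpl in *; tauto.
Qed.

Lemma ge_real_Glb (S : R -> Prop) (m : R) :
  (exists s, S s) -> (forall s, S s -> m <= s) -> m <= real (Glb_Rbar S).
Proof.
  intros [r hr] lb. destruct (Glb_Rbar_correct S) as [h1 h2].
  assert (I1 := h1 r hr). assert (I2 : Rbar_le m (Glb_Rbar S)) by (apply h2; exact lb).
  destruct (Glb_Rbar S) as [l| |]; simpl in *; tauto.
Qed.

Lemma le_sup_norm (X H Y : hilbert) (f : X * H -> Y) (z : X * H) :
  globally_bounded f -> norm (f z) <= sup_norm f.
Proof.
  intros [M hM]. apply (le_real_Lub _ M); [|now exists z].
  intros s [z' ->]. apply hM.
Qed.

Lemma spectrum_on_ext (H : hilbert) (V V' : H -> Prop) (A : operator H) (l : R) :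
  (forall x, V x <-> V' x) -> spectrum_on V A l -> spectrum_on V' A l.
Proof.
  intros e h [B [h1 [h2 [M h3]]]]. apply h. exists B. split; [|split].
  - intros y hy. destruct (h1 y) as [k1 k2]; [now apply e|].
    split; [now apply e | assumption].
  - intros x hx dx. destruct (h2 x) as [k1 k2]; [now apply e | assumption|].
    split; [now apply e | assumption].
  - exists M. intros y hy. apply h3. now apply e.
Qed.

Lemma is_linear_orth_proj (H : hilbert) (V : H -> Prop) :
  closed_subspace H V -> is_linear (fun x : H => orth_proj V x).
Proof.
  intros CV. split.
  - intros x y. exact (orth_proj_plus H V x y CV).
  - intros k x. exact (orth_proj_scal H V k x CV).
  - exists 1. split; [lra|]. intros x. rewrite Rmult_1_l. exact (norm_orth_proj_le H V x CV).
Qed.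

Lemma orth_proj_minus (H : hilbert) (V : H -> Prop) (x y : H) :
  closed_subspace H V ->
  orth_proj V (minus x y) = minus (orth_proj V x) (orth_proj V y).
Proof. intros CV. exact (linear_minus_H H _ x y (is_linear_orth_proj H V CV)). Qed.

Lemma is_linear_orth_compl (H : hilbert) (V : H -> Prop) :
  closed_subspace H V -> is_linear (fun x : H => minus x (orth_proj V x)).
Proof.
  intros CV. split.
  - intros x y. refine (eq_trans (f_equal (minus _) (orth_proj_plus H V x y CV)) _). vec.
  - intros k x. refine (eq_trans (f_equal (minus _) (orth_proj_scal H V k x CV)) _). vec.
  - exists 1. split; [lra|]. intros x. rewrite Rmult_1_l. exact (norm_orth_compl_le H V x CV).
Qed.

(** * Low and high modes of the slow operator *)

Lemma range_orth_proj (H : hilbert) (V : H -> Prop) (x : H) :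
  closed_subspace H V -> range (orth_proj V) x <-> V x.
Proof.
  intros CV. split.
  - intros [y ->]. now apply orth_proj_spec.
  - intros hx. exists x. symmetry. now apply orth_proj_of_mem.
Qed.

Lemma range_orth_compl (H : hilbert) (V : H -> Prop) (x : H) :
  closed_subspace H V -> range (fun v => minus v (orth_proj V v)) x <-> perp H V x.
Proof.
  intros CV. split.
  - intros [y ->]. now apply orth_proj_spec.
  - intros hx. exists x. rewrite orth_proj_of_perp by assumption. vec.
Qed.

Lemma reduces_dense (H : hilbert) (A : operator H) (W : H -> Prop) (x : H) (r : R) :
  densely_defined A -> closed_subspace H W -> reduces H A W -> W x -> 0 < r ->
  exists y, W y /\ dom A y /\ norm (minus x y) < r.
Proof.
  intros dens CW RW hx hr. destruct (dens x r hr) as [y [dy n]].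
  exists (orth_proj W y). split; [now apply orth_proj_spec|]. split; [now apply RW|].
  rewrite <- (orth_proj_of_mem H W x CW hx) at 1.
  rewrite <- orth_proj_minus by assumption.
  eapply Rle_lt_trans; [now apply norm_orth_proj_le | assumption].
Qed.

(** Spelled so that [orth_proj (low_modes H A mu eps)] is convertible to [P_ A mu eps]. *)
Definition low_modes (H : hilbert) (A : operator H) (mu eps : R) : H -> Prop :=
  closed_span (fun x => exists l, (0 <= l <= mu * / eps ^ 2) /\ dom A x /\ A x = scal l x).

Lemma closed_subspace_low_modes (H : hilbert) (A : operator H) (mu eps : R) :
  closed_subspace H (low_modes H A mu eps).
Proof. apply closed_subspace_closed_span. Qed.

(** Below [mu / eps ^ 2] the spectral gap gives coercivity, hence resolvents, and the shift [/ eps]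
    only increases [alpha_]. The nonzero high mode excludes an empty spectrum, for which
    [lambda_plus] would be 0. *)
Lemma alpha_lower (H : hilbert) (A : operator H) (mu eps : R) :
  self_adjoint A -> bounded_below A 0 -> compact_resolvent A -> 0 < mu -> 0 < eps ->
  (exists w, perp H (low_modes H A mu eps) w /\ w <> zero) ->
  mu / eps ^ 2 <= alpha_ A mu eps.
Proof.
  intros SA BA CA hmu heps ex.
  destruct (spectral_gap H A (mu * / eps ^ 2) SA BA CA) as [RW [low top]].
  fold (low_modes H A mu eps) in RW, low, top.
  assert (CV := closed_subspace_low_modes H A mu eps).
  assert (rg : forall x, perp H (low_modes H A mu eps) x <-> range (Q_ A mu eps) x).
  { intros x. symmetry. exact (range_orth_compl H (low_modes H A mu eps) x CV). }
  unfold alpha_. apply Rle_trans with (lambda_plus A mu eps).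
  - apply ge_real_Glb.
    + destruct (top ex) as [l hl]. exists l. exact (spectrum_on_ext H _ _ A l rg hl).
    + intros l hl. apply Rnot_lt_le. intros lt.
      apply (spectrum_on_ext H _ (perp H (low_modes H A mu eps))) in hl;
        [|intros x; symmetry; apply rg].
      apply hl. apply (resolvent_exists H A _ l (mu / eps ^ 2 - l) SA);
        [apply closed_subspace_perp | assumption | lra|].
      intros w hw dw. replace (l + (mu / eps ^ 2 - l)) with (mu / eps ^ 2) by ring.
      now apply low.
  - assert (0 < / eps) by now apply Rinv_0_lt_compat. lra.
Qed.

(** Serves both components: [Q] is the identity for the fast variable and the projection onto the
    high modes for the slow one, where only [Q] after [E s] decays at rate [c]. *)
Lemma duhamel_bound (H : hilbert) (E : R -> H -> H) (Q : H -> H) (g : R -> H)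
    (c M t : R) (v0 v : H) :
  0 < c -> 0 <= t -> is_linear Q ->
  (forall s x, 0 <= s -> norm (Q (E s x)) <= exp (- c * s) * norm x) ->
  (forall s, norm (g s) <= M) ->
  is_RInt (fun s => E (t - s) (g s)) 0 t (minus v (E t v0)) ->
  norm (Q v) <= exp (- c * t) * norm v0 + M / c.
Proof.
  intros hc ht LQ dec hM hI.
  assert (hI2 := is_RInt_linear H Q _ 0 t _ LQ hI).
  rewrite (linear_minus_H H Q) in hI2 by assumption.
  assert (I1 : norm (minus (Q v) (Q (E t v0))) <= M / c).
  { refine (norm_is_RInt_exp_le H _ c M t _ ht hc _ _ hI2).
    - intros s hs. eapply Rle_trans; [apply dec; lra|].
      apply Rmult_le_compat_l; [left; apply exp_pos | apply hM].
    - eapply Rle_trans; [apply norm_nonneg | apply (hM 0)]. }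
  assert (I2 := norm_le_minus _ (Q v) (Q (E t v0))).
  assert (I3 := dec t v0 ht). lra.
Qed.

(** Freezing the orbit at negative times gives continuity on the whole line, the form in which
    [gronwall] asks for it. *)
Lemma continuous_Rmax_flow (X H : hilbert) (S : R -> X * H -> X * H) (z : X * H) :
  (forall t, 0 <= t ->
     filterlim (fun s => S s z) (within (fun s => 0 <= s) (locally t))
       (locally (S t z))) ->
  forall t, continuous (fun s => S (Rmax 0 s) z) t.
Proof.
  intros C t.
  apply (filterlim_comp _ _ _ (Rmax 0) (fun s => S s z) _
    (within (fun s => 0 <= s) (locally (Rmax 0 t)))); [|apply C, Rmax_l].
  intros U [[d hd] h]. exists (mkposreal d hd). intros s hs.
  change (Rabs (s - t) < d) in hs. apply h; [|apply Rmax_l].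
  change (Rabs (Rmax 0 s - Rmax 0 t) < d). apply Rabs_def2 in hs.
  unfold Rmax. destruct (Rle_dec 0 s), (Rle_dec 0 t); apply Rabs_def1; lra.
Qed.

(** [eta] bounds the fast and high-mode differences together. The relation between [E'] and [E] lets
    both low-mode equations be written with the same contraction [E]. *)
Lemma low_modes_comparison (X H : hilbert) (V : H -> Prop) (g : X * H -> H)
    (L eta T : R) (S S' : R -> X * H -> X * H) (E E' : R -> H -> H) (z w : X * H) :
  closed_subspace H V ->
  lipschitz_with (@pnorm X H) norm (@everywhere (X * H)) g L ->
  (forall t, continuous (fun s => S (Rmax 0 s) z) t) ->
  (forall t, continuous (fun s => S' (Rmax 0 s) w) t) ->
  (forall t, 0 <= t -> is_linear (E t)) ->
  (forall t x, 0 <= t -> orth_proj V (E t x) = E t (orth_proj V x)) ->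
  (forall t x, 0 <= t -> orth_proj V (E' t x) = E t (orth_proj V x)) ->
  (forall t x, 0 <= t -> norm (E t x) <= norm x) ->
  (forall t, 0 <= t ->
     is_RInt (fun s => E (t - s) (g (S s z))) 0 t (minus (snd (S t z)) (E t (snd z)))) ->
  (forall t, 0 <= t ->
     is_RInt (fun s => E' (t - s) (g (S' s w))) 0 t
       (minus (snd (S' t w)) (E' t (snd w)))) ->
  orth_proj V (snd z) = orth_proj V (snd w) ->
  0 <= T -> 0 <= eta ->
  (forall s, 0 <= s <= T ->
     norm (minus (fst (S s z)) (fst (S' s w))) +
     norm (minus (minus (snd (S s z)) (snd (S' s w)))
       (orth_proj V (minus (snd (S s z)) (snd (S' s w))))) <= eta) ->
  pnorm (minus (S T z) (S' T w)) <= exp (L * T) * eta.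
Proof.
  intros CV [hL lip] CS CS' EL PE PE' EB D1 D2 hp hT heta fast.
  set (dv := fun s => minus (snd (S (Rmax 0 s) z)) (snd (S' (Rmax 0 s) w))).
  set (D := fun s => norm (orth_proj V (dv s))).
  assert (CD : forall s, continuous D s).
  { intros s. apply continuous_norm_H.
    apply (continuous_comp dv (fun x : H => orth_proj V x)).
    - unfold dv, minus.
      apply (continuous_plus (fun s => snd (S (Rmax 0 s) z))
               (fun s => opp (snd (S' (Rmax 0 s) w)))).
      + apply (continuous_comp (fun s => S (Rmax 0 s) z) (@snd X H)); [apply CS|].
        apply continuous_snd.
      + apply (continuous_opp (fun s => snd (S' (Rmax 0 s) w))).
        apply (continuous_comp (fun s => S' (Rmax 0 s) w) (@snd X H)); [apply CS'|].
        apply continuous_snd.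
    - apply (linear_cont (fun x : H => orth_proj V x)). now apply is_linear_orth_proj. }
  assert (dvE : forall s, 0 <= s -> dv s = minus (snd (S s z)) (snd (S' s w))).
  { intros s hs. unfold dv. now rewrite Rmax_right. }
  assert (tot : forall s, 0 <= s <= T -> pnorm (minus (S s z) (S' s w)) <= eta + D s).
  { intros s hs. specialize (fast s hs). unfold D. rewrite dvE by lra.
    change (pnorm (minus (S s z) (S' s w))) with
      (norm (minus (fst (S s z)) (fst (S' s w)))
        + norm (minus (snd (S s z)) (snd (S' s w)))).
    assert (I1 := norm_le_minus _ (minus (snd (S s z)) (snd (S' s w)))
      (orth_proj V (minus (snd (S s z)) (snd (S' s w))))). lra. }
  assert (G : D T + eta <= exp (L * T) * eta).
  { apply gronwall; try assumption. intros t ht.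
    unfold D at 1. rewrite dvE by lra.
    assert (hI : is_RInt (fun s => orth_proj V
        (minus (E (t - s) (g (S s z))) (E' (t - s) (g (S' s w))))) 0 t
        (orth_proj V (minus (snd (S t z)) (snd (S' t w))))).
    (* After projection the two initial terms coincide by [hp], so only the integrals remain. *)
    { replace (orth_proj V (minus (snd (S t z)) (snd (S' t w)))) with
        (orth_proj V (minus (minus (snd (S t z)) (E t (snd z)))
                        (minus (snd (S' t w)) (E' t (snd w))))).
      - apply (is_RInt_linear H (fun x => orth_proj V x));
          [now apply is_linear_orth_proj|].
        apply (is_RInt_minus (V := H)); [apply D1 | apply D2]; lra.
      - rewrite !orth_proj_minus, PE, PE', hp by (assumption || lra). vec. }
    refine (norm_RInt_le _ _ 0 t _ _ (proj1 ht) _ hI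
      (RInt_correct (fun s => L * (eta + D s)) 0 t _)).
    - intros s hs.
      assert (Et : orth_proj V (minus (E (t - s) (g (S s z))) (E' (t - s) (g (S' s w))))
        = E (t - s) (orth_proj V (minus (g (S s z)) (g (S' s w))))).
      { rewrite !orth_proj_minus, PE, PE' by (assumption || lra).
        rewrite (linear_minus_H H (E (t - s))); [reflexivity | apply EL; lra]. }
      rewrite Et. eapply Rle_trans; [apply EB; lra|].
      eapply Rle_trans; [now apply norm_orth_proj_le|].
      eapply Rle_trans; [now apply lip|].
      apply Rmult_le_compat_l; [assumption|]. apply tot. lra.
    - apply ex_RInt_continuous. intros s _.
      apply (continuous_mult (fun _ => L) (fun s => eta + D s)); [apply continuous_const|].
      apply (continuous_plus (fun _ => eta) D); [apply continuous_const | apply CD]. }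
  assert (I1 := tot T ltac:(lra)). lra.
Qed.

(** * Decay rates and action on the low modes *)

Lemma fast_semigroup_decay (X : hilbert) (Af : operator X) (E : R -> X -> X)
    (omega delta : R) :
  self_adjoint Af -> bounded_below Af omega -> 0 < delta ->
  is_semigroup_of (scal_op (/ delta) Af) E ->
  forall t (x : X), 0 <= t -> norm (E t x) <= exp (- (omega / delta) * t) * norm x.
Proof.
  intros SA BA hd SG t x ht.
  apply (semigroup_decay X (scal_op (/ delta) Af) E (@everywhere X));
    [assumption | assumption | intros; exact I | | | exact I].
  - intros y _ dy. specialize (BA y dy). simpl. rewrite inner_scal.
    assert (0 < / delta) by now apply Rinv_0_lt_compat.
    apply (Rmult_le_compat_l (/ delta)) in BA; [|lra]. unfold Rdiv. lra.
  - intros y r _ hr. destruct SA as [_ [dens _]].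
    destruct (dens y r hr) as [w [dw n]]. exists w. now split.
Qed.

Lemma low_modes_eigen (H : hilbert) (A : operator H) (mu eps : R) (e : H) :
  self_adjoint A ->
  (exists l, (0 <= l <= mu * / eps ^ 2) /\ dom A e /\ A e = scal l e) ->
  exists l, (dom A e /\ A e = scal l e) /\
    forall z, dom A z -> inner (A z) e = l * inner z e.
Proof.
  intros SA [l [_ [de ee]]]. exists l. split; [now split|].
  intros z dz. now rewrite (self_adjoint_sym H A z e SA dz de), ee, inner_scal_r.
Qed.

Lemma slow_semigroup (H : hilbert) (A : operator H) (E : R -> H -> H) (mu eps : R) :
  self_adjoint A -> bounded_below A 0 -> compact_resolvent A ->
  is_semigroup_of A E ->
  let P := orth_proj (low_modes H A mu eps) in
  (forall t x, 0 <= t -> P (E t x) = E t (P x)) /\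
  (forall t (x : H), 0 <= t -> norm (E t x) <= norm x) /\
  (forall t (x : H), 0 <= t ->
     norm (minus (E t x) (P (E t x))) <= exp (- (mu / eps ^ 2) * t) * norm x).
Proof.
  intros SA BA CA SG P.
  destruct (spectral_gap H A (mu * / eps ^ 2) SA BA CA) as [RW [low _]].
  fold (low_modes H A mu eps) in RW, low.
  assert (CV := closed_subspace_low_modes H A mu eps).
  assert (CW := closed_subspace_perp H (low_modes H A mu eps)).
  assert (dens := proj1 (proj2 SA)).
  assert (EW : forall t x, 0 <= t -> perp H (low_modes H A mu eps) x ->
            perp H (low_modes H A mu eps) (E t x)).
  { intros t x ht. apply (semigroup_eigenspace_perp H A E); [assumption | assumption | |].
    - intros e he. destruct (low_modes_eigen H A mu eps e SA he) as [l [_ h]]. now exists l.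
    - intros y r hy hr. now apply (reduces_dense H A). }
  assert (PE : forall t x, 0 <= t -> P (E t x) = E t (P x)).
  { intros t x ht. apply proj_commutes; [assumption | now apply SG | |].
    - apply (semigroup_eigenspace H A E); [assumption | assumption|].
      intros e he. destruct (low_modes_eigen H A mu eps e SA he) as [l [h _]]. now exists l.
    - intros y hy. now apply EW. }
  split; [assumption|]. split.
  - intros t x ht. replace (norm x) with (exp (- 0 * t) * norm x)
      by (replace (- 0 * t) with 0 by ring; rewrite exp_0; ring).
    apply (semigroup_decay H A E (@everywhere H));
      [assumption | assumption | intros; exact I | | | exact I].
    + intros y _ dy. now apply BA.
    + intros y r _ hr. destruct (dens y r hr) as [w [dw n]]. exists w. now split.
  - intros t x ht. rewrite PE by assumption.
    rewrite <- (linear_minus_H H (E t)) by now apply SG.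
    apply Rle_trans with (exp (- (mu / eps ^ 2) * t) * norm (minus x (P x))).
    + apply (semigroup_decay H A E (perp H (low_modes H A mu eps)));
        [assumption | assumption | assumption | assumption | |].
      * intros y r hy hr. now apply (reduces_dense H A).
      * now apply orth_proj_spec.
    + apply Rmult_le_compat_l; [left; apply exp_pos | now apply norm_orth_compl_le].
Qed.

(** The correction [/ eps] times [Q_] vanishes on low eigenvectors and has range orthogonal to them.
    So [As_] has the same eigenvectors there, in the strong and in the weak sense, and its semigroup
    preserves both subspaces and agrees with [E] on the low modes. *)
Lemma renormalized_low_modes (H : hilbert) (A : operator H) (E E' : R -> H -> H)
    (mu eps : R) :
  self_adjoint A -> bounded_below A 0 -> compact_resolvent A ->
  is_semigroup_of A E -> is_semigroup_of (As_ A mu eps) E' ->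
  let P := orth_proj (low_modes H A mu eps) in
  forall t x, 0 <= t -> P (E' t x) = E t (P x).
Proof.
  intros SA BA CA SG SG' P t x ht.
  destruct (spectral_gap H A (mu * / eps ^ 2) SA BA CA) as [RW _].
  fold (low_modes H A mu eps) in RW.
  assert (CV := closed_subspace_low_modes H A mu eps).
  assert (CW := closed_subspace_perp H (low_modes H A mu eps)).
  assert (dens := proj1 (proj2 SA)).
  assert (eig : forall e,
    (exists l, (0 <= l <= mu * / eps ^ 2) /\ dom A e /\ A e = scal l e) ->
    exists l, (dom A e /\ A e = scal l e) /\ As_ A mu eps e = scal l e /\
      forall z, dom A z -> inner (As_ A mu eps z) e = l * inner z e).
  { intros e he. assert (hV : low_modes H A mu eps e) by now apply closed_span_mem.
    destruct (low_modes_eigen H A mu eps e SA he) as [l [[de ee] sym]].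
    exists l. split; [now split|]. split.
    - change (plus (A e) (scal (/ eps) (minus e (P e))) = scal l e).
      unfold P. rewrite orth_proj_of_mem, ee by assumption. vec.
    - intros z dz.
      change (inner (plus (A z) (scal (/ eps) (minus z (P z)))) e = l * inner z e).
      destruct (orth_proj_spec H _ z CV) as [_ pp]. specialize (pp e hV).
      rewrite inner_plus, inner_scal. unfold P. rewrite pp, sym by assumption. ring. }
  transitivity (E' t (P x)).
  - apply proj_commutes; [assumption | now apply SG' | |].
    + apply (semigroup_eigenspace H (As_ A mu eps) E'); [assumption | assumption|].
      intros e he. destruct (eig e he) as [l [[de _] [h _]]]. now exists l.
    + apply (semigroup_eigenspace_perp H (As_ A mu eps) E'); [assumption | assumption | |].
      * intros e he. destruct (eig e he) as [l [_ [_ h]]]. now exists l.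
      * intros y r hy hr. now apply (reduces_dense H A).
  - symmetry. apply (closed_span_incl H _ (fun y => E t y = E' t y))
      with (3 := proj1 (orth_proj_spec H _ x CV)).
    + apply closed_subspace_equalizer; [now apply SG | now apply SG'].
    + intros e he. destruct (eig e he) as [l [[de ee] [h _]]].
      now apply (semigroup_eigenvector_unique H A (As_ A mu eps) E E' e l).
Qed.

(** Improves the manifold bound [sup_norm g / alpha_] to order [eps ^ 2]. When [hq p] is nonzero it
    is itself the high mode that [alpha_lower] requires; otherwise the bound is trivial. *)
Lemma slow_manifold_high_modes (X H : hilbert) (As : operator H)
    (f : X * H -> X) (g : X * H -> H) (mu omega delta eps : R)
    (S : R -> X * H -> X * H) (hu : H -> X) (hq : H -> H) (p : H) :
  self_adjoint As -> bounded_below As 0 -> compact_resolvent As ->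
  0 < mu -> 0 < eps -> globally_bounded g ->
  is_slow_manifold As f g mu omega delta eps S hu hq ->
  low_modes H As mu eps p ->
  perp H (low_modes H As mu eps) (hq p) /\ norm (hq p) <= sup_norm g * eps ^ 2 / mu.
Proof.
  intros SA BA CA hmu heps bg [M1 [_ [M3 _]]] hp.
  assert (CV := closed_subspace_low_modes H As mu eps).
  assert (hP : range (P_ As mu eps) p).
  { exact (proj2 (range_orth_proj H (low_modes H As mu eps) p CV) hp). }
  assert (hW : perp H (low_modes H As mu eps) (hq p)).
  { apply (range_orth_compl H _ _ CV). exact (M1 p hP). }
  split; [assumption|].
  assert (gn : 0 <= sup_norm g).
  { eapply Rle_trans; [apply norm_nonneg | exact (le_sup_norm X H H g (zero, zero) bg)]. }
  assert (0 < eps ^ 2) by nra.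
  assert (pos : 0 <= sup_norm g * eps ^ 2 / mu).
  { apply Rmult_le_pos; [nra | left; now apply Rinv_0_lt_compat]. }
  destruct (classic (hq p = zero)) as [Z|nz]; [now rewrite Z, norm_zero_eq|].
  assert (al := alpha_lower H As mu eps SA BA CA hmu heps
    (ex_intro _ (hq p) (conj hW nz))).
  eapply Rle_trans; [exact (M3 p hP)|].
  assert (0 < mu / eps ^ 2) by now apply Rdiv_lt_0_compat.
  replace (sup_norm g * eps ^ 2 / mu) with (sup_norm g * / (mu / eps ^ 2)) by (field; lra).
  apply Rmult_le_compat_l; [assumption|]. now apply Rinv_le_contravar.
Qed.

(** Explains the transient time: [k / a] times the absolute logarithm of [x] is the time after which
    decay at rate [a] has reached [x] to the power [k]. *)
Lemma exp_le_Rpower (a x t k : R) :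
  0 < a -> 0 < x <= 1 -> k / a * Rabs (ln x) <= t -> exp (- a * t) <= Rpower x k.
Proof.
  intros ha hx ht. apply exp_monotone.
  assert (L : ln x <= 0).
  { rewrite <- ln_1.
    destruct hx as [h1 [h2| ->]]; [left; now apply ln_increasing | now right]. }
  rewrite Rabs_left1 in ht by assumption.
  apply (Rmult_le_compat_l a) in ht; [|lra].
  replace (a * (k / a * - ln x)) with (- (k * ln x)) in ht by (field; lra). lra.
Qed.

Theorem theorem8p6 :
  forall (X H : hilbert) (Af : operator X) (As : operator H)
    (f : X * H -> X) (g : X * H -> H) (omega mu : R)
    (Sd : R -> R -> X * H -> X * H)
    (Sde : R -> R -> R -> X * H -> X * H)
    (Fam : R -> R -> Prop)
    (hu : R -> R -> H -> X) (hq : R -> R -> H -> H),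
  infinite_dimensional H ->
  0 < omega ->
  self_adjoint Af ->
  bounded_below Af omega ->
  self_adjoint As ->
  bounded_below As 0 ->
  compact_resolvent As ->
  globally_bounded f -> globally_lipschitz f ->
  globally_bounded g -> globally_lipschitz g ->
  0 < mu ->
  (forall delta, 0 < delta <= 1 ->
     is_mild_semiflow (scal_op (/ delta) Af) As f g (Sd delta)) ->
  (forall delta eps, 0 < delta <= 1 -> 0 < eps <= 1 ->
     is_mild_semiflow (scal_op (/ delta) Af) (As_ As mu eps) f g
       (Sde delta eps)) ->
  (forall delta eps, Fam delta eps ->
     0 < delta <= 1 /\ 0 < eps <= 1 /\
     0 < G_ As mu omega delta eps /\ K_ As f g mu omega delta eps < 1) ->
  (forall delta eps, Fam delta eps ->
     is_slow_manifold As f g mu omega delta eps (Sde delta eps)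
       (hu delta eps) (hq delta eps)) ->
  forall B : X * H -> Prop, bounded_set B ->
  forall T : R, 0 < T ->
  exists C_T : R,
  forall kappa : R, 0 < kappa ->
  exists r : R, 0 < r /\
  forall delta eps, Fam delta eps -> delta < r -> eps < r ->
  let tau := tau_ mu omega kappa delta eps in
  tau < T ->
  forall z0, B z0 -> forall t, tau <= t <= T ->
  pnorm (minus (Sd delta t z0)
           (Sde delta eps (t - tau)
              (retraction As mu eps (hu delta eps) (hq delta eps)
                 (Sd delta tau z0))))
  <= C_T * (R_u B * Rpower delta kappa + R_v B * Rpower eps kappa
            + delta + eps ^ 2).
Proof.
  intros X H Af As f g omega mu Sd Sde Fam hu hq _ homega SAf BAf SAs BAs CAs
    bf lf bg [L lip] hmu flow flowe params manifold B [MB hMB] T hT.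
  set (Mf := sup_norm f). set (Mg := sup_norm g).
  assert (fM : forall z, norm (f z) <= Mf) by (intros z; now apply le_sup_norm).
  assert (gM : forall z, norm (g z) <= Mg) by (intros z; now apply le_sup_norm).
  assert (Mf0 : 0 <= Mf) by (eapply Rle_trans; [apply norm_nonneg | exact (fM (zero, zero))]).
  assert (Mg0 : 0 <= Mg) by (eapply Rle_trans; [apply norm_nonneg | exact (gM (zero, zero))]).
  assert (hL : 0 <= L) by apply lip.
  (* [L] is a Lipschitz constant of [g]. Each factor 2 counts the full solution and the manifold;
     [kappa] enters only through the powers, so the constant precedes it. *)
  exists (exp (L * T) * (1 + 2 * Mf / omega + 2 * Mg / mu)).
  intros kappa hk. exists 1. split; [lra|].
  intros delta eps hF _ _ tau htau z0 hz0 t ht.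
  destruct (params delta eps hF) as [hd [he _]].
  specialize (flow delta hd). specialize (flowe delta eps hd he).
  specialize (manifold delta eps hF).
  set (S := Sd delta) in *. set (S' := Sde delta eps) in *.
  set (h := hu delta eps) in *. set (q := hq delta eps) in *.
  destruct flow as [S0 [SS [SC [Eu [Ev [SGu [SGv D]]]]]]].
  destruct flowe as [S0' [SS' [SC' [Eu' [Ev' [_ [SGv' D']]]]]]].
  set (V := low_modes H As mu eps).
  assert (CV : closed_subspace H V) by apply closed_subspace_low_modes.
  assert (tau0 : 0 <= tau).
  { unfold tau, tau_. eapply Rle_trans; [|apply Rmax_l].
    apply Rmult_le_pos; [|apply Rabs_pos].
    apply Rmult_le_pos; [nra | left; now apply Rinv_0_lt_compat]. }
  assert (pe2 : 0 < eps ^ 2) by nra.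
  assert (Lam : 0 < mu / eps ^ 2) by now apply Rdiv_lt_0_compat.
  assert (Om : 0 < omega / delta) by (apply Rdiv_lt_0_compat; lra).
  destruct (slow_semigroup H As Ev mu eps SAs BAs CAs SGv) as [PE [EB EQ]].
  assert (PE' := renormalized_low_modes H As Ev Ev' mu eps SAs BAs CAs SGv SGv').
  cbv zeta in PE'. fold V in PE, EQ, PE'.
  assert (Edec := fast_semigroup_decay X Af Eu omega delta SAf BAf (proj1 hd) SGu).
  assert (hRu : norm (fst z0) <= R_u B).
  { apply (le_real_Lub _ MB); [|now exists z0]. intros r [z [hz ->]].
    specialize (hMB z hz). unfold pnorm in hMB. assert (I1 := norm_nonneg _ (snd z)). lra. }
  assert (hRv : norm (snd z0) <= R_v B).
  { apply (le_real_Lub _ MB); [|now exists z0]. intros r [z [hz ->]].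
    specialize (hMB z hz). unfold pnorm in hMB. assert (I1 := norm_nonneg _ (fst z)). lra. }
  assert (Ru0 := Rle_trans _ _ _ (norm_nonneg _ _) hRu).
  assert (Rv0 := Rle_trans _ _ _ (norm_nonneg _ _) hRv).
  set (dk := Rpower delta kappa). set (ek := Rpower eps kappa).
  assert (dk0 : 0 < dk) by apply exp_pos. assert (ek0 : 0 < ek) by apply exp_pos.
  assert (ubound : forall s, tau <= s ->
            norm (fst (S s z0)) <= R_u B * dk + Mf * delta / omega).
  { intros s hs.
    assert (I1 := duhamel_bound X Eu (fun x => x) (fun r => f (S r z0)) (omega / delta) Mf s
      (fst z0) (fst (S s z0)) Om ltac:(lra) is_linear_id Edec (fun r => fM _)
      (proj1 (D z0 s ltac:(lra)))). simpl in I1.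
    assert (I2 : exp (- (omega / delta) * s) <= dk).
    { apply exp_le_Rpower; [assumption | lra|].
      apply Rle_trans with tau; [|assumption].
      replace (kappa / (omega / delta)) with (kappa * delta / omega) by (field; lra).
      apply Rmax_l. }
    replace (Mf / (omega / delta)) with (Mf * delta / omega) in I1 by (field; lra).
    assert (exp (- (omega / delta) * s) * norm (fst z0) <= dk * R_u B).
    { apply Rmult_le_compat; (assumption || apply norm_nonneg || left; apply exp_pos). }
    lra. }
  assert (vbound : forall s, tau <= s ->
            norm (minus (snd (S s z0)) (orth_proj V (snd (S s z0))))
            <= R_v B * ek + Mg * eps ^ 2 / mu).
  { intros s hs.
    assert (I1 := duhamel_bound H Ev (fun x => minus x (orth_proj V x))
      (fun r => g (S r z0)) (mu / eps ^ 2) Mg s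
      (snd z0) (snd (S s z0)) Lam ltac:(lra) (is_linear_orth_compl H V CV) EQ
      (fun r => gM _) (proj2 (D z0 s ltac:(lra)))).
    assert (I2 : exp (- (mu / eps ^ 2) * s) <= ek).
    { apply exp_le_Rpower; [assumption | lra|].
      apply Rle_trans with tau; [|assumption].
      replace (kappa / (mu / eps ^ 2)) with (kappa / mu * eps ^ 2) by (field; lra).
      apply Rmax_r. }
    replace (Mg / (mu / eps ^ 2)) with (Mg * eps ^ 2 / mu) in I1 by (field; lra).
    assert (exp (- (mu / eps ^ 2) * s) * norm (snd z0) <= ek * R_v B).
    { apply Rmult_le_compat; (assumption || apply norm_nonneg || left; apply exp_pos). }
    cbv beta in I1. lra. }
  set (z1 := S tau z0).
  set (p1 := orth_proj V (snd z1)).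
  assert (hp1 : V p1) by now apply orth_proj_spec.
  set (w1 := J_ h q p1).
  change (retraction As mu eps h q (S tau z0)) with w1.
  assert (high : forall p, V p -> perp H V (q p) /\ norm (q p) <= Mg * eps ^ 2 / mu).
  { intros p hp. apply (slow_manifold_high_modes X H As f g mu omega delta eps S' h q p);
      (assumption || lra). }
  assert (rgV : forall p, range (P_ As mu eps) p <-> V p)
    by (intros p; exact (range_orth_proj H V p CV)).
  assert (onM : forall s, 0 <= s -> exists p, V p /\ S' s w1 = J_ h q p).
  { intros s hs. destruct manifold as [_ [_ [_ [_ [_ [_ inv]]]]]].
    destruct (inv s w1 hs) as [p [hp E]].
    - exists p1. split; [now apply rgV | reflexivity].
    - exists p. split; [now apply rgV | exact E]. }
  (* Initial layers of the full solution, then the forcing terms of that solution together with the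
     equal bounds on the manifold. *)
  set (eta := R_u B * dk + R_v B * ek + 2 * (Mf * delta / omega)
              + 2 * (Mg * eps ^ 2 / mu)).
  assert (a1 : 0 <= Mf * delta / omega).
  { apply Rmult_le_pos; [nra | left; now apply Rinv_0_lt_compat]. }
  assert (a2 : 0 <= Mg * eps ^ 2 / mu).
  { apply Rmult_le_pos; [nra | left; now apply Rinv_0_lt_compat]. }
  assert (a3 : 0 <= R_u B * dk) by (apply Rmult_le_pos; lra).
  assert (a4 : 0 <= R_v B * ek) by (apply Rmult_le_pos; lra).
  assert (main : pnorm (minus (S (t - tau) z1) (S' (t - tau) w1))
                 <= exp (L * (t - tau)) * eta).
  { apply (low_modes_comparison X H V g L eta (t - tau) S S' Ev Ev' z1 w1);
      try assumption.
    - exact (continuous_Rmax_flow X H S z1 (SC z1)).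
    - exact (continuous_Rmax_flow X H S' w1 (SC' w1)).
    - apply SGv.
    - intros s hs. exact (proj2 (D z1 s hs)).
    - intros s hs. exact (proj2 (D' w1 s hs)).
    (* The retraction keeps the low modes [p1] and adds a vector orthogonal to them, so both
       solutions start with the same low modes. *)
    - unfold w1, J_. simpl snd. rewrite orth_proj_plus by assumption.
      rewrite (orth_proj_of_mem H V p1 CV hp1).
      rewrite (orth_proj_of_perp H V (q p1) CV (proj1 (high p1 hp1))). fold p1. vec.
    - lra.
    - unfold eta. lra.
    - intros s hs. destruct (onM s (proj1 hs)) as [p [hp ->]].
      unfold z1. rewrite <- SS by lra.
      assert (I1 := ubound (s + tau) ltac:(lra)).
      assert (I2 := vbound (s + tau) ltac:(lra)).
      set (y := S (s + tau) z0) in *.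
      unfold J_. simpl fst. simpl snd.
      assert (I3 : norm (h p) <= Mf * delta / omega).
      { destruct manifold as [_ [hu' _]]. apply hu'. now apply rgV. }
      destruct (high p hp) as [hq1 hq2].
      assert (I4 := norm_minus_le _ (fst y) (h p)).
      assert (E : minus (minus (snd y) (plus p (q p)))
                    (orth_proj V (minus (snd y) (plus p (q p))))
          = minus (minus (snd y) (orth_proj V (snd y))) (q p)).
      { rewrite orth_proj_minus, orth_proj_plus by assumption.
        rewrite (orth_proj_of_mem H V p CV hp), (orth_proj_of_perp H V (q p) CV hq1). vec. }
      rewrite E.
      assert (I5 := norm_minus_le _ (minus (snd y) (orth_proj V (snd y))) (q p)).
      unfold eta. lra. }
  replace t with ((t - tau) + tau) at 1 by ring.
  rewrite SS by lra. fold z1. eapply Rle_trans; [exact main|].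
  assert (e1 : exp (L * (t - tau)) <= exp (L * T)).
  { apply exp_monotone, Rmult_le_compat_l; lra. }
  apply Rle_trans with (exp (L * T) * eta).
  { apply Rmult_le_compat_r; [unfold eta; lra | assumption]. }
  rewrite Rmult_assoc. apply Rmult_le_compat_l; [left; apply exp_pos|].
  set (a := R_u B * dk + R_v B * ek) in *.
  set (bf' := Mf / omega). set (bg' := Mg / mu).
  assert (b1 : 0 <= bf') by (apply Rmult_le_pos; [lra | left; now apply Rinv_0_lt_compat]).
  assert (b2 : 0 <= bg') by (apply Rmult_le_pos; [lra | left; now apply Rinv_0_lt_compat]).
  replace eta with (a + 2 * bf' * delta + 2 * bg' * eps ^ 2)
    by (unfold eta, a, bf', bg'; field; lra).
  replace (1 + 2 * Mf / omega + 2 * Mg / mu) with (1 + 2 * bf' + 2 * bg')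
    by (unfold bf', bg'; field; lra).
  (* These are the cross terms by which the product on the right exceeds the required sum. *)
  assert (0 <= bf' * (a + eps ^ 2)) by (apply Rmult_le_pos; unfold a; lra).
  assert (0 <= bg' * (a + delta)) by (apply Rmult_le_pos; unfold a; lra).
  lra.
Qed.
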